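(* Let $\mathbf U_{\beta,\xi}$ be the Drinfeld double $\widehat{\mathfrak f}^+\otimes\widehat{\mathfrak f}^-$ with respect to the skew-Hopf pairing $\widehat{\mathfrak f}^+\times\widehat{\mathfrak f}^-\to\mathbb F$ induced by $\phi$. Writing $E_i,K_i,J_i$ for $E_i\otimes1$, $K_i\otimes 1$, $J_i\otimes 1$ and $F_i,K'_i,J'_i$ for $1\otimes F_i$, $1\otimes K'_i$, $1\otimes J'_i$, the $\mathbb F$-algebra $\mathbf U_{\beta,\xi}$ is presented by generators $E_i,F_i,J_i^{\pm1},J_i'^{\pm1},K_i^{\pm1},K_i'^{\pm1}$ ($i\in I$) and the following relations (for all $i,j\in I$): (R1) the elements $J_i^{\pm1},J_i'^{\pm1},K_i^{\pm1},K_i'^{\pm1}$ commute with each other, and $K_i^{\pm1}K_i^{\mp1}=K_i'^{\pm1}K_i'^{\mp1}=J_i^{\pm1}J_i^{\mp1}=J_i'^{\pm1}J_i'^{\mp1}=1$; (R2) $K_iE_j=\langle i,j\rangle E_jK_i$, $K'_iE_j=\langle j,i\rangle^{-1}\xi(i,j)E_jK'_i$, $K_iF_j=\langle i,j\rangle^{-1}F_jK_i$, $K'_iF_j=\langle j,i\rangle\xi(i,j)^{-1}F_jK'_i$, $J_iE_j=\xi(j,i)E_jJ_i$, $J'_iE_j=E_jJ'_i$, $J_iF_j=\xi(j,i)^{-1}F_jJ_i$, $J'_iF_j=F_jJ'_i$; (R3) $E_iF_j-\xi(j,i)^{-1}F_jE_i=\delta_{ij}\dfrac{K_iJ'_i-J_iK'_i}{v_i-v_i^{-1}}$;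 (R4) for $i\ne j$, $\sum_{k+k'=1-a_{ij}}(-1)^k\beta(i,j)^{-k}E_i^{(k)}E_jE_i^{(k')}=0$ and $\sum_{k+k'=1-a_{ij}}(-1)^k\beta(i,j)^{-k}F_i^{(k')}F_jF_i^{(k)}=0$.
   Context: Cartan datum: $I$ is a finite set with a symmetric $\mathbb Z$-valued bilinear form $\cdot$ on $\mathbb Z[I]$ such that $i\cdot i\in\{2,4,\dots\}$ and $a_{ij}:=2\frac{i\cdot j}{i\cdot i}\in\{0,-1,-2,\dots\}$ for $i\ne j$. Put $v_i=v^{i\cdot i/2}$, $v$ an indeterminate; $\mathbb F$ is a field containing $\mathbb Q(v)$. Multiplicative bilinear forms $\mathbb N[I]\times\mathbb N[I]\to\mathbb F\setminus\{0\}$ are maps multiplicative in each (additive) variable; they are extended to $\mathbb Z[I]\times\mathbb Z[I]$. Fix such forms $\beta$ with $\beta(i,j)\beta(j,i)=1$, $\beta(i,i)=1$ for all $i,j\in I$, and $\xi$ symmetric with $\xi(i,i)^{1/2}\in\mathbb F$ for all $i\in I$. Let $\langle\cdot,\cdot\rangle$ be the multiplicative bilinear form with $\langle i,j\rangle=v^{-i\cdot j}\beta(i,j)\xi(j,i)$. Divided powers: $X^{(n)}=X^n/[n]^!_{v_i}$ for $X\in\{\theta_i,E_i,F_i\}$, where $[n]^!_c=\prod_{k=1}^n[k]_c$, $[k]_c=\frac{c^k-c^{-k}}{c-c^{-1}}$; sums over $k+k'=1-a_{ij}$ are over $k,k'\ge0$. Skew-Hopf pairing of Hopf algebras $A,B$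 over $\mathbb F$: a bilinear form $\psi:A\times B\to\mathbb F$ with (a) $\psi(1,y)=\varepsilon_B(y)$, $\psi(x,1)=\varepsilon_A(x)$; (b) $\psi(x,y'y'')=\psi(\Delta_A(x),y'\otimes y'')$; (c) $\psi(x'x'',y)=\psi(x'\otimes x'',\Delta_B^{\rm op}(y))$; (d) $\psi(S_A(x),y)=\psi(x,S_B^{-1}(y))$; here $\psi(x'\otimes x'',y'\otimes y'')=\psi(x',y')\psi(x'',y'')$ and $\Delta_B^{\rm op}$ is the opposite comultiplication. Drinfeld double: given such $\psi$, the space $A\otimes B$ is an algebra with $(x\otimes1)(x'\otimes1)=xx'\otimes1$, $(1\otimes y)(1\otimes y')=1\otimes yy'$, $(x\otimes1)(1\otimes y)=x\otimes y$, $(1\otimes y)(x\otimes1)=\sum\psi(x_1,S_B(y_1))\,x_2\otimes y_2\,\psi(x_3,y_3)$, where $\Delta_A^2(x)=\sum x_1\otimes x_2\otimes x_3$, $\Delta_B^2(y)=\sum y_1\otimes y_2\otimes y_3$ (it is a Hopf algebra with tensor product coalgebra structure). Let ${}'\mathfrak f$, ${}'\mathfrak f^+$, ${}'\mathfrak f^-$ be the free unital associative $\mathbb F$-algebras on $\{\theta_i\}$, $\{E_i\}$, $\{F_i\}$ ($i\in I$), $\mathbb N[I]$-graded with $\theta_i,E_i,F_i$ in degree $i$; $|x|$ denotes degree. Let $\iota^+:{}'\mathfrak f\to{}'\mathfrak f^+$ be the algebra isomorphism $\theta_i\mapsto E_i$ and $\iota^-:{}'\mathfrak f\to{}'\mathfrak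 f^-$ the algebra anti-isomorphism $\theta_i\mapsto F_i$. $\widehat{{}'\mathfrak f^+}$ is the algebra generated by ${}'\mathfrak f^+$ and commuting invertible $K_i,J_i$ with $K_iE_jK_i^{-1}=\langle i,j\rangle E_j$, $J_iE_jJ_i^{-1}=\xi(j,i)E_j$ (a semidirect product). $\widehat{{}'\mathfrak f^-}$ is the algebra similarly generated by ${}'\mathfrak f^-$ and commuting invertible $K'_i,J'_i$ with $K'_iF_jK_i'^{-1}=\langle j,i\rangle\xi(i,j)^{-1}F_j$, $J'_iF_jJ_i'^{-1}=F_j$. For $\nu=\sum\nu_ii\in\mathbb Z[I]$, $K_\nu=\prod K_i^{\nu_i}$, and similarly $J_\nu,K'_\nu,J'_\nu$. These are Hopf algebras: $K_i,J_i,K'_i,J'_i$ are group-like; $\Delta_+(E_i)=E_i\otimes J_i+K_i\otimes E_i$, $\varepsilon_+(E_i)=0$, $S_+(E_i)=-K_i^{-1}E_iJ_i^{-1}$; $\Delta_-(F_i)=J'_i\otimes F_i+F_i\otimes K'_i$, $\varepsilon_-(F_i)=0$, $S_-(F_i)=-J_i'^{-1}F_iK_i'^{-1}$. For $\nu\in\mathbb Z[I]$, $j\in I$ define linear endomorphisms of $\widehat{{}'\mathfrak f^-}$ (for $\tau_1,\tau_2\in\mathbb Z[I]$, homogeneous $x\in{}'\mathfrak f^-$): $\mathcal K_\nu(K'_{\tau_1}xJ'_{\tau_2})=\langle\nu,\tau_1\rangle\langle\nu,|x|\rangle K'_{\tau_1}xJ'_{\tau_2}$; $\mathcal J_\nu(K'_{\tau_1}xJ'_{\tau_2})=\xi(\tau_1,\nu)\xi(|x|,\nu)K'_{\tau_1}xJ'_{\tau_2}$;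 and ${}_j\mathcal S$ with ${}_j\mathcal S(K'_{\tau_1}J'_{\tau_2})=0$, ${}_j\mathcal S(F_i)=\delta_{ij}\xi(i,j)$, ${}_j\mathcal S(xy)={}_j\mathcal S(x)\mathcal J_j(y)+\mathcal K_j(x)\,{}_j\mathcal S(y)$ for all $x,y\in\widehat{{}'\mathfrak f^-}$. Let $\rho^+:\widehat{{}'\mathfrak f^+}\to\operatorname{Hom}_{\mathbb F}(\widehat{{}'\mathfrak f^-},\widehat{{}'\mathfrak f^-})$ be the algebra anti-homomorphism with $E_j\mapsto(v_j^{-1}-v_j)^{-1}{}_j\mathcal S$, $K_\nu\mapsto\mathcal K_\nu$, $J_\nu\mapsto\mathcal J_\nu$, and $\phi(x,y)=\varepsilon_-(\rho^+(x)y)$ for $x\in\widehat{{}'\mathfrak f^+}$, $y\in\widehat{{}'\mathfrak f^-}$. For $i\ne j$ let $D_{ij}=\sum_{k+k'=1-a_{ij}}(-1)^k\beta(i,j)^{-k}\theta_i^{(k)}\theta_j\theta_i^{(k')}\in{}'\mathfrak f$. Let $\widehat{\mathfrak J^\pm}$ be the ideal of $\widehat{{}'\mathfrak f^\pm}$ generated by all $\iota^\pm(D_{ij})$, $i\ne j$, and $\widehat{\mathfrak f}^\pm=\widehat{{}'\mathfrak f^\pm}/\widehat{\mathfrak J^\pm}$, with the induced Hopf algebra structures; $\phi$ induces a well-defined skew-Hopf pairing $\widehat{\mathfrak f}^+\times\widehat{\mathfrak f}^-\to\mathbb F$. *)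

(* Defs.v *)
From HB Require Import structures.
From mathcomp Require Import all_boot all_order all_algebra.
From mathcomp Require Import sesquilinear ring_quotient fraction boolp.
From mathcomp Require Import finmap.
From mathcomp Require Import monalg.

Set Implicit Arguments.
Unset Strict Implicit.
Unset Printing Implicit Defensive.

Import GRing.Theory.
Local Open Scope ring_scope.

Section Presentations.
Variable F : fieldType.

Inductive ideal_gen (A : nzRingType) (S : A -> Prop) : A -> Prop :=
| Ideal_gen x : S x -> ideal_gen S x
| Ideal_0 : ideal_gen S 0
| Ideal_add x y : ideal_gen S x -> ideal_gen S y -> ideal_gen S (x + y)
| Ideal_mul a x b : ideal_gen S x -> ideal_gen S (a * x * b).

(** For an algebra morphism [f : A -> B]: [f] identifies [B] with the quotient
    of [A] by the two-sided ideal generated by [S]. *)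
Definition is_quotient (A B : nzRingType) (f : A -> B) (S : A -> Prop) : Prop :=
  (forall b, exists a, f a = b) /\ (forall a, f a = 0 <-> ideal_gen S a).

(** The free unital associative algebra on [G]; its basis is the free monoid
    [{fmonom G}] of words in [G]. *)
Local Notation free_alg G := {malg F[{fmonom G}]}.

Definition letter (G : choiceType) (g : G) : free_alg G := << fmu g >>.

(** The algebra morphism, resp. anti-morphism, with prescribed values on [G]. *)
Definition eval (G : choiceType) (A : lalgType F) (h : G -> A)
    (x : free_alg G) : A :=
  mmap (GRing.in_alg A) (fun w : {fmonom G} => \prod_(g <- w) h g) x.
Definition anti_eval (G : choiceType) (A : lalgType F) (h : G -> A)
    (x : free_alg G) : A :=
  mmap (GRing.in_alg A) (fun w : {fmonom G} => \prod_(g <- rev w) h g) x.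

(** [A] is presented by the generators [h g] and the relations [lhs = rhs]
    for [R lhs rhs]. *)
Definition presented_by (G : choiceType) (A : lalgType F) (h : G -> A)
    (R : free_alg G -> free_alg G -> Prop) : Prop :=
  is_quotient (eval h) (fun z => exists lhs rhs, R lhs rhs /\ z = lhs - rhs).

End Presentations.

Notation free_alg F G := {malg F[{fmonom G}]}.

Section Tensor.
Variables (F : fieldType) (A B : lmodType F).

(** [A (x) B] is the quotient of the space with basis [A * B] by the span of
    the bilinearity relations. *)
Inductive tens_null : {malg F[(A * B)%type]} -> Prop :=
| Tens_null_0 : tens_null 0
| Tens_null_lin c x y :
    tens_null x -> tens_null y -> tens_null (c *: x + y)
| Tens_null_l c a a' b :
    tens_null (<< (c *: a + a', b) >> - (c *: << (a, b) >> + << (a', b) >>))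
| Tens_null_r c a b b' :
    tens_null (<< (a, c *: b + b') >> - (c *: << (a, b) >> + << (a, b') >>)).

Definition tens_null_pred : {pred {malg F[(A * B)%type]}} :=
  fun x => `[< tens_null x >].

Lemma tens_nullP x : reflect (tens_null x) (x \in tens_null_pred).
Proof. exact: asboolP. Qed.

Lemma tens_nullZ c x : tens_null x -> tens_null (c *: x).
Proof.
by move=> nx; rewrite -[_ *: _]addr0; apply: Tens_null_lin => //; apply: Tens_null_0.
Qed.

Lemma tens_null_zmod : zmod_closed tens_null_pred.
Proof.
split=> [|x y /tens_nullP nx /tens_nullP ny]; apply/tens_nullP.
  exact: Tens_null_0.
by rewrite addrC -scaleN1r; apply: Tens_null_lin.
Qed.

HB.instance Definition _ :=
  GRing.isZmodClosed.Build _ tens_null_pred tens_null_zmod.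

Definition tens := Quotient.quot tens_null_pred.
HB.instance Definition _ := GRing.Zmodule.on tens.

Local Notation pi := (\pi_(Quotient.quot tens_null_pred))%qT.

Definition tens_scale (c : F) (x : tens) : tens := pi (c *: repr x).

Lemma pi_tens_eq x y : (pi x = pi y :> tens) <-> tens_null (x - y).
Proof.
split=> [/eqP|nxy]; first by rewrite -Quotient.idealrBE => /tens_nullP.
by apply/eqP; rewrite -Quotient.idealrBE; apply/tens_nullP.
Qed.

Lemma pi_tens_scale c x : tens_scale c (pi x) = pi (c *: x).
Proof.
apply/pi_tens_eq; rewrite -scalerBr; apply: tens_nullZ.
by apply/pi_tens_eq; rewrite reprK.
Qed.

Lemma pi_tensD x y : pi (x + y) = (pi x : tens) + pi y.
Proof. exact: Quotient.pi_add. Qed.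

Lemma tens_scaleA c d x : tens_scale c (tens_scale d x) = tens_scale (c * d) x.
Proof.
rewrite -[x]reprK; move: (repr x) => {}x.
by rewrite (pi_tens_scale d) (pi_tens_scale c) (pi_tens_scale (c * d)) scalerA.
Qed.

Lemma tens_scale1 : left_id 1 tens_scale.
Proof.
by move=> x; rewrite -[x]reprK; move: (repr x) => {}x; rewrite pi_tens_scale scale1r.
Qed.

Lemma tens_scaleDr : right_distributive tens_scale +%R.
Proof.
move=> c x y; rewrite -[x]reprK -[y]reprK; move: (repr x) (repr y) => {}x {}y.
rewrite -pi_tensD (pi_tens_scale c (x + y)) (pi_tens_scale c x).
by rewrite (pi_tens_scale c y) -pi_tensD scalerDr.
Qed.

Lemma tens_scaleDl x : {morph tens_scale^~ x : c d / c + d}.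
Proof.
move=> c d; rewrite -[x]reprK; move: (repr x) => {}x.
rewrite (pi_tens_scale (c + d)) (pi_tens_scale c) (pi_tens_scale d).
by rewrite -pi_tensD scalerDl.
Qed.

HB.instance Definition _ := GRing.Zmodule_isLmodule.Build F tens
  tens_scaleA tens_scale1 tens_scaleDr tens_scaleDl.

Definition pure (a : A) (b : B) : tens := pi << (a, b) >>.

(** The linear map [a (x) b |-> f a b]; meaningful for bilinear [f], see
    [tens_lift_linear] and [tens_lift_pure]. *)
Definition tens_lift (V : lmodType F) (f : A -> B -> V) (x : tens) : V :=
  \sum_(p <- msupp (repr x)) (repr x)@_p *: f p.1 p.2.

Definition is_bilinear (V : lmodType F) (f : A -> B -> V) : Prop :=
  (forall b, linear (f^~ b)) /\ (forall a, linear (f a)).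

Section Lift.
Variables (V : lmodType F) (f : A -> B -> V).

Let sumf (x : {malg F[(A * B)%type]}) : V :=
  \sum_(p <- msupp x) x@_p *: f p.1 p.2.

Let sumf_le (d : {fset A * B}) x : (msupp x `<=` d)%fset ->
  sumf x = \sum_(p <- d) x@_p *: f p.1 p.2.
Proof.
move=> le; rewrite /sumf (big_fset_incl _ le) // => p _ /mcoeff_outdom ->.
by rewrite scale0r.
Qed.

Let sumf_linear : linear sumf.
Proof.
move=> c x y.
have le1 : (msupp (c *: x + y) `<=` msupp x `|` msupp y)%fset.
  apply: fsubset_trans (msuppD_le _ _) _.
  by apply: fsetSU; apply: msuppZ_le.
rewrite (sumf_le le1) (sumf_le (fsubsetUl (msupp x) (msupp y))).
rewrite (sumf_le (fsubsetUr (msupp x) (msupp y))) scaler_sumr -big_split /=.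
by apply: eq_bigr => p _; rewrite mcoeffD mcoeffZ scalerDl scalerA.
Qed.

Let sumfU p : sumf << p >> = f p.1 p.2.
Proof. by rewrite (sumf_le msuppU_le) big_seq_fset1 mcoeffUU scale1r. Qed.

Hypothesis fP : is_bilinear f.

Let sumf0 : sumf 0 = 0.
Proof. by rewrite /sumf msupp0 big_nil. Qed.

Let sumfZ c x : sumf (c *: x) = c *: sumf x.
Proof. by rewrite -[c *: x]addr0 sumf_linear sumf0 addr0. Qed.

Let sumfD x y : sumf (x + y) = sumf x + sumf y.
Proof. by rewrite -[x in LHS]scale1r sumf_linear scale1r. Qed.

Let sumfB x y : sumf (x - y) = sumf x - sumf y.
Proof. by rewrite sumfD -[- y]scaleN1r sumfZ scaleN1r. Qed.

Let sumf_null x : tens_null x -> sumf x = 0.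
Proof.
case: fP => fl fr.
elim=> {x} [|c x y _ sx _ sy|c a a' b|c a b b']; first exact: sumf0.
- by rewrite sumf_linear sx sy scaler0 addr0.
- by rewrite sumfB sumf_linear !sumfU /= fl subrr.
- by rewrite sumfB sumf_linear !sumfU /= fr subrr.
Qed.

Let tens_lift_pi x : tens_lift f (pi x) = sumf x.
Proof.
apply/eqP; rewrite -subr_eq0; apply/eqP; rewrite -[LHS]sumfB.
by apply: sumf_null; apply/pi_tens_eq; rewrite reprK.
Qed.

Lemma tens_lift_pure a b : tens_lift f (pure a b) = f a b.
Proof. by rewrite tens_lift_pi sumfU. Qed.

Lemma tens_lift_linear : linear (tens_lift f).
Proof.
move=> c x y; rewrite -[x]reprK -[y]reprK.
rewrite -[c *: _]/(tens_scale _ _) pi_tens_scale -pi_tensD !tens_lift_pi.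
exact: sumf_linear.
Qed.

End Lift.

End Tensor.

Notation "a ⊗ b" := (pure a b) (at level 40, left associativity) : ring_scope.

Section Hopf.
Variable F : fieldType.

Definition tens_map (A B C D : lmodType F) (f : A -> C) (g : B -> D) :
    tens A B -> tens C D := tens_lift (fun a b => f a ⊗ g b).

Definition tens_assoc (A B C : lmodType F) :
    tens (tens A B) C -> tens A (tens B C) :=
  tens_lift (fun ab c => tens_lift (fun a b => a ⊗ (b ⊗ c)) ab).

Definition tens_swap (A B : lmodType F) : tens A B -> tens B A :=
  tens_lift (fun a b => b ⊗ a).

Definition tens_mul (A B : algType F) (x y : tens A B) : tens A B :=
  tens_lift (fun a b => tens_lift (fun a' b' => (a * a') ⊗ (b * b')) y) x.

Record hopf_algebra (A : algType F) := HopfAlgebra {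
  comul : {linear A -> tens A A};
  counit : {lrmorphism A -> F | *%R};
  antipode : {linear A -> A};
  comul1 : comul 1 = 1 ⊗ 1;
  comulM : forall x y, comul (x * y) = tens_mul (comul x) (comul y);
  comulA : forall x,
    tens_assoc (tens_map comul idfun (comul x))
      = tens_map idfun comul (comul x);
  counit_l : forall x, tens_lift (fun a b => counit a *: b) (comul x) = x;
  counit_r : forall x, tens_lift (fun a b => counit b *: a) (comul x) = x;
  antipode_l : forall x,
    tens_lift (fun a b => antipode a * b) (comul x) = (counit x)%:A;
  antipode_r : forall x,
    tens_lift (fun a b => a * antipode b) (comul x) = (counit x)%:A }.

Definition hopf_morphism (A B : algType F) (HA : hopf_algebra A)
    (HB : hopf_algebra B) (f : {lrmorphism A -> B}) : Prop :=
  [/\ forall x, comul HB (f x) = tens_map f f (comul HA x),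
      forall x, counit HB (f x) = counit HA x
    & forall x, antipode HB (f x) = f (antipode HA x)].

(** [comul2 x] is the sum of the [(x_1 (x) x_2) (x) x_3]. *)
Definition comul2 (A : algType F) (HA : hopf_algebra A) (x : A) :
    tens (tens A A) A := tens_map (comul HA) idfun (comul HA x).

(** The extension of [psi] to [A (x) A] and [B (x) B]. *)
Definition pairing2 (A B : lmodType F) (psi : A -> B -> F)
    (X : tens A A) (Y : tens B B) : F^o :=
  tens_lift (fun x' x'' =>
    tens_lift (fun y' y'' => psi x' y' * psi x'' y'' : F^o) Y) X.

Definition skew_hopf_pairing (A B : algType F) (HA : hopf_algebra A)
    (HB : hopf_algebra B) (psi : {bilinear A -> B -> F | *%R & *%R}) : Prop :=
  [/\ (forall y, psi 1 y = counit HB y) /\ (forall x, psi x 1 = counit HA x),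
      forall x y' y'', psi x (y' * y'') = pairing2 psi (comul HA x) (y' ⊗ y''),
      forall x' x'' y,
        psi (x' * x'') y = pairing2 psi (x' ⊗ x'') (tens_swap (comul HB y))
    & exists Sinv : B -> B,
        [/\ cancel (antipode HB) Sinv, cancel Sinv (antipode HB)
          & forall x y, psi (antipode HA x) y = psi x (Sinv y)]].

(** [straighten X Y] is the sum of the
    [psi(x_1, S_B(y_1)) x_2 (x) y_2 psi(x_3, y_3)]. *)
Definition straighten (A B : algType F) (HB : hopf_algebra B)
    (psi : A -> B -> F) (X : tens (tens A A) A) (Y : tens (tens B B) B) :
    tens A B :=
  tens_lift (fun x12 x3 => tens_lift (fun x1 x2 =>
    tens_lift (fun y12 y3 => tens_lift (fun y1 y2 =>
      (psi x1 (antipode HB y1) * psi x3 y3) *: (x2 ⊗ y2)) y12) Y) x12) X.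

(** [U] is the Drinfeld double of [A] and [B]: [t] transports the algebra
    structure of [U] to the space [A (x) B]. *)
Definition is_drinfeld_double (A B : algType F) (HA : hopf_algebra A)
    (HB : hopf_algebra B) (psi : A -> B -> F)
    (U : algType F) (t : {linear tens A B -> U}) : Prop :=
  [/\ bijective t,
      forall x x', t (x ⊗ 1) * t (x' ⊗ 1) = t ((x * x') ⊗ 1),
      forall y y', t (1 ⊗ y) * t (1 ⊗ y') = t (1 ⊗ (y * y')),
      forall x y, t (x ⊗ 1) * t (1 ⊗ y) = t (x ⊗ y)
    & forall x y, t (1 ⊗ y) * t (x ⊗ 1)
        = t (straighten HB psi (comul2 HA x) (comul2 HB y))].

End Hopf.

Notation lattice I := {ffun I -> int}.

Definition simple (I : finType) (i : I) : lattice I := [ffun j => (j == i)%:R].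

Record cartan_datum (I : finType) := CartanDatum {
  dot : lattice I -> lattice I -> int;
  dotDl : forall mu nu tau, dot (mu + nu) tau = dot mu tau + dot nu tau;
  dotC : forall mu nu, dot mu nu = dot nu mu;
  dot_diag : forall i, exists n : nat,
    dot (simple i) (simple i) = (2 * n.+1)%:Z;
  dot_offdiag : forall i j, i != j -> exists n : nat,
    2 * dot (simple i) (simple j) = - n%:Z * dot (simple i) (simple i) }.

Definition mult_bilinear (F : fieldType) (I : finType)
    (b : lattice I -> lattice I -> F) : Prop :=
  [/\ forall mu nu, b mu nu != 0,
      forall mu nu tau, b (mu + nu) tau = b mu tau * b nu tau
    & forall mu nu tau, b mu (nu + tau) = b mu nu * b mu tau].

(** The inclusion of [Q(v)] in [F] and the forms [beta] and [xi]. Since a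
    multiplicative form on N[I] extends uniquely to Z[I], the forms are taken
    on Z[I] from the start. *)
Record parameters (F : fieldType) (I : finType) := BuildParameters {
  Qv : {rmorphism {fraction {poly rat}} -> F};
  datum : cartan_datum I;
  beta : lattice I -> lattice I -> F;
  xi : lattice I -> lattice I -> F;
  beta_mult : mult_bilinear beta;
  beta_inv : forall i j,
    beta (simple i) (simple j) * beta (simple j) (simple i) = 1;
  beta_diag : forall i, beta (simple i) (simple i) = 1;
  xi_mult : mult_bilinear xi;
  xi_sym : forall mu nu, xi mu nu = xi nu mu;
  xi_sqrt : forall i, exists s : F, s ^+ 2 = xi (simple i) (simple i) }.

Section Params.
Variables (F : fieldType) (I : finType) (P : parameters F I).

Definition v : F := Qv P (tofrac 'X).

Definition v_ (i : I) : F :=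
  v ^ (dot (datum P) (simple i) (simple i) %/ 2)%Z.

Definition a_ (i j : I) : int :=
  (2 * dot (datum P) (simple i) (simple j)
     %/ dot (datum P) (simple i) (simple i))%Z.

(** [1 - a_ij], a natural number when [i != j]. *)
Definition serre_len (i j : I) : nat := absz (1 - a_ i j).

(** The multiplicative bilinear form with
    [<i, j> = v^(- i.j) beta(i, j) xi(j, i)]. *)
Definition bracket (mu nu : lattice I) : F :=
  v ^ (- dot (datum P) mu nu) * beta P mu nu * xi P nu mu.

Definition qint (c : F) (k : nat) : F := (c ^+ k - c ^- k) / (c - c^-1).
Definition qfact (c : F) (n : nat) : F := \prod_(1 <= k < n.+1) qint c k.

(** The divided power [x^(n)] of a generator [x] attached to [i]. *)
Definition divpow (A : lalgType F) (i : I) (x : A) (n : nat) : A :=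
  (qfact (v_ i) n)^-1 *: x ^+ n.

Definition serre_coef (i j : I) (k : nat) : F :=
  (-1) ^+ k * beta P (simple i) (simple j) ^- k.

(** The element [D_ij] of the free algebra on the [theta_i]. *)
Definition D_ (i j : I) : free_alg F I :=
  \sum_(k < (serre_len i j).+1) serre_coef i j k *:
    (divpow i (letter F i) k * letter F j
       * divpow i (letter F i) (serre_len i j - k)).

End Params.

(** Generators of both halves: [HX i] is [E_i] or [F_i]; [HK true i] and
    [HK false i] are [K_i] and its inverse, or [K'_i] and its inverse;
    similarly [HJ] for [J_i] or [J'_i]. *)
Inductive half_gen (I : Type) := HX of I | HK of bool & I | HJ of bool & I.
Arguments HX {I}.
Arguments HK {I}.
Arguments HJ {I}.

Definition half_gen_code (I : Type) (g : half_gen I) : I + bool * I + bool * I :=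
  match g with
  | HX i => inl (inl i) | HK s i => inl (inr (s, i)) | HJ s i => inr (s, i)
  end.
Definition half_gen_decode (I : Type) (c : I + bool * I + bool * I) :=
  match c with
  | inl (inl i) => HX i | inl (inr (s, i)) => HK s i | inr (s, i) => HJ s i
  end.
Lemma half_gen_codeK (I : Type) :
  cancel (@half_gen_code I) (@half_gen_decode I).
Proof. by case. Qed.
HB.instance Definition _ (I : choiceType) :=
  Choice.copy (half_gen I) (can_type (@half_gen_codeK I)).

Definition is_torus (I : Type) (g : half_gen I) : bool :=
  if g is HX _ then false else true.

Section Halves.
Variables (F : fieldType) (I : finType) (P : parameters F I).

(** Relations with [K_i X_j K_i^-1 = cK i j X_j], [J_i X_j J_i^-1 = cJ i j X_j]. *)
Inductive half_relation (cK cJ : I -> I -> F) :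
    free_alg F (half_gen I) -> free_alg F (half_gen I) -> Prop :=
| Half_comm g h : is_torus g -> is_torus h ->
    half_relation cK cJ (letter F g * letter F h) (letter F h * letter F g)
| Half_invK s i :
    half_relation cK cJ (letter F (HK s i) * letter F (HK (~~ s) i)) 1
| Half_invJ s i :
    half_relation cK cJ (letter F (HJ s i) * letter F (HJ (~~ s) i)) 1
| Half_KX i j :
    half_relation cK cJ
      (letter F (HK true i) * letter F (HX j) * letter F (HK false i))
      (cK i j *: letter F (HX j))
| Half_JX i j :
    half_relation cK cJ
      (letter F (HJ true i) * letter F (HX j) * letter F (HJ false i))
      (cJ i j *: letter F (HX j)).

Definition plus_relation := half_relation
  (fun i j => bracket P (simple i) (simple j))
  (fun i j => xi P (simple j) (simple i)).

Definition minus_relation := half_relation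
  (fun i j => bracket P (simple j) (simple i) * (xi P (simple i) (simple j))^-1)
  (fun i j => 1).

Definition plus_hopf_spec (A : algType F) (g : half_gen I -> A)
    (H : hopf_algebra A) : Prop :=
  let E i := g (HX i) in let K i := g (HK true i) in
  let J i := g (HJ true i) in
  let Kinv i := g (HK false i) in let Jinv i := g (HJ false i) in
  [/\ forall h, is_torus h -> comul H (g h) = g h ⊗ g h /\ counit H (g h) = 1,
      forall i, comul H (E i) = E i ⊗ J i + K i ⊗ E i,
      forall i, counit H (E i) = 0
    & forall i, antipode H (E i) = - (Kinv i * E i * Jinv i)].

Definition minus_hopf_spec (A : algType F) (g : half_gen I -> A)
    (H : hopf_algebra A) : Prop :=
  let Fg i := g (HX i) in let K' i := g (HK true i) in
  let J' i := g (HJ true i) in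
  let K'inv i := g (HK false i) in let J'inv i := g (HJ false i) in
  [/\ forall h, is_torus h -> comul H (g h) = g h ⊗ g h /\ counit H (g h) = 1,
      forall i, comul H (Fg i) = J' i ⊗ Fg i + Fg i ⊗ K' i,
      forall i, counit H (Fg i) = 0
    & forall i, antipode H (Fg i) = - (J'inv i * Fg i * K'inv i)].

(** [zpower x y n] is [x ^ n], where [y] is the inverse of [x]. *)
Definition zpower (A : nzRingType) (x y : A) (n : int) : A :=
  match n with Posz k => x ^+ k | Negz k => y ^+ k.+1 end.

Definition K_ (A : algType F) (g : half_gen I -> A) (nu : lattice I) : A :=
  \prod_(i : I) zpower (g (HK true i)) (g (HK false i)) (nu i).
Definition J_ (A : algType F) (g : half_gen I -> A) (nu : lattice I) : A :=
  \prod_(i : I) zpower (g (HJ true i)) (g (HJ false i)) (nu i).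

Definition word_degree (w : {fmonom I}) : lattice I :=
  \sum_(i <- w : seq I) simple i.

Definition homogeneous (x : free_alg F I) (d : lattice I) : Prop :=
  forall w, w \in msupp x -> word_degree w = d.

(** The operators [calK nu], [calJ nu] and [S j] on [hat 'f-] (here [A], with
    generators [g]). *)
Definition minus_operators (A : algType F) (g : half_gen I -> A)
    (calK calJ : lattice I -> {linear A -> A}) (S : I -> {linear A -> A}) :=
  let Fg i := g (HX i) in
  [/\ forall nu tau1 tau2 x d, homogeneous x d ->
        let m := K_ g tau1 * eval Fg x * J_ g tau2 in
        calK nu m = (bracket P nu tau1 * bracket P nu d) *: m,
      forall nu tau1 tau2 x d, homogeneous x d ->
        let m := K_ g tau1 * eval Fg x * J_ g tau2 in
        calJ nu m = (xi P tau1 nu * xi P d nu) *: m,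
      forall j tau1 tau2, S j (K_ g tau1 * J_ g tau2) = 0,
      forall i j, S j (Fg i)
        = (if i == j then xi P (simple i) (simple j) else 0)%:A
    & forall j x y,
        S j (x * y) = S j x * calJ (simple j) y + calK (simple j) x * S j y].

(** [rho+ : hat 'f+ -> Hom(hat 'f-, hat 'f-)]; the elements of the target are
    written as functions, so that [rho] is curried. *)
Definition plus_action (Ap Am : algType F) (gp : half_gen I -> Ap)
    (calK calJ : lattice I -> {linear Am -> Am}) (S : I -> {linear Am -> Am})
    (rho : {bilinear Ap -> Am -> Am}) : Prop :=
  [/\ forall y, rho 1 y = y,
      forall x x' y, rho (x * x') y = rho x' (rho x y),
      forall j y, rho (gp (HX j)) y = ((v_ P j)^-1 - v_ P j)^-1 *: S j y,
      forall nu y, rho (K_ gp nu) y = calK nu y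
    & forall nu y, rho (J_ gp nu) y = calJ nu y].

(** [phi] is the form [phi(x, y) = eps_-(rho+(x) y)]. *)
Definition is_phi (Ap Am : algType F) (gp : half_gen I -> Ap)
    (gm : half_gen I -> Am) (Hm : hopf_algebra Am)
    (phi : Ap -> Am -> F) : Prop :=
  exists calK calJ S rho,
    [/\ minus_operators gm calK calJ S, plus_action gp calK calJ S rho
      & forall x y, phi x y = counit Hm (rho x y)].

(** [iota+] is the evaluation at the [E_i]; [iota-] reverses words. *)
Definition plus_serre (A : algType F) (g : half_gen I -> A) (x : A) : Prop :=
  exists i j, i != j /\ x = eval (fun i => g (HX i)) (D_ P i j).
Definition minus_serre (A : algType F) (g : half_gen I -> A) (x : A) : Prop :=
  exists i j, i != j /\ x = anti_eval (fun i => g (HX i)) (D_ P i j).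

End Halves.

Section DoubleRelations.
Variables (F : fieldType) (I : finType) (P : parameters F I).

(** [inl] gives the generators [E_i], [K_i^{+-1}], [J_i^{+-1}] and [inr] gives
    [F_i], [K'_i^{+-1}], [J'_i^{+-1}]. *)
Definition double_gen := (half_gen I + half_gen I)%type.

Let L (g : double_gen) : free_alg F double_gen := letter F g.
Local Notation E i := (L (inl (HX i))).
Local Notation K i := (L (inl (HK true i))).
Local Notation J i := (L (inl (HJ true i))).
Local Notation F_ i := (L (inr (HX i))).
Local Notation K' i := (L (inr (HK true i))).
Local Notation J' i := (L (inr (HJ true i))).
Local Notation "⟨ i , j ⟩" := (bracket P (simple i) (simple j)).
Local Notation ξ i j := (xi P (simple i) (simple j)).

Definition is_double_torus (g : double_gen) : bool :=
  match g with inl h | inr h => is_torus h end.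

Inductive double_relation :
    free_alg F double_gen -> free_alg F double_gen -> Prop :=
| Torus_comm g h : is_double_torus g -> is_double_torus h ->
    double_relation (L g * L h) (L h * L g)
| Torus_K s i : double_relation (L (inl (HK s i)) * L (inl (HK (~~ s) i))) 1
| Torus_K' s i : double_relation (L (inr (HK s i)) * L (inr (HK (~~ s) i))) 1
| Torus_J s i : double_relation (L (inl (HJ s i)) * L (inl (HJ (~~ s) i))) 1
| Torus_J' s i : double_relation (L (inr (HJ s i)) * L (inr (HJ (~~ s) i))) 1
| Act_KE i j : double_relation (K i * E j) (⟨i, j⟩ *: (E j * K i))
| Act_K'E i j :
    double_relation (K' i * E j) ((⟨j, i⟩^-1 * ξ i j) *: (E j * K' i))
| Act_KF i j : double_relation (K i * F_ j) (⟨i, j⟩^-1 *: (F_ j * K i))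
| Act_K'F i j :
    double_relation (K' i * F_ j) ((⟨j, i⟩ * (ξ i j)^-1) *: (F_ j * K' i))
| Act_JE i j : double_relation (J i * E j) (ξ j i *: (E j * J i))
| Act_J'E i j : double_relation (J' i * E j) (E j * J' i)
| Act_JF i j : double_relation (J i * F_ j) ((ξ j i)^-1 *: (F_ j * J i))
| Act_J'F i j : double_relation (J' i * F_ j) (F_ j * J' i)
| Cross i j :
    double_relation (E i * F_ j - (ξ j i)^-1 *: (F_ j * E i))
      (if i == j then
         (v_ P i - (v_ P i)^-1)^-1 *: (K i * J' i - J i * K' i)
       else 0)
| Serre_E i j : i != j ->
    double_relation
      (\sum_(k < (serre_len P i j).+1) serre_coef P i j k *:
         (divpow P i (E i) k * E j * divpow P i (E i) (serre_len P i j - k)))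
      0
| Serre_F i j : i != j ->
    double_relation
      (\sum_(k < (serre_len P i j).+1) serre_coef P i j k *:
         (divpow P i (F_ i) (serre_len P i j - k) * F_ j
            * divpow P i (F_ i) k))
      0.

End DoubleRelations.

(* Main.v *)
Require Import Defs.
From HB Require Import structures.
From mathcomp Require Import all_boot all_order all_algebra.
From mathcomp Require Import sesquilinear ring_quotient fraction boolp finmap.
From mathcomp Require Import monalg.

Set Implicit Arguments.
Unset Strict Implicit.
Unset Printing Implicit Defensive.

Import GRing.Theory.
Local Open Scope ring_scope.

(** Let [T] be the free algebra on the generators and [u : T -> U] its
    evaluation in the double. Two things have to be shown.

    The relations hold in [U]. Those inside one half come from the presentation
    of that half, and the Serre relations from the quotient. For the mixed ones
    the exchange rule [y x = sum psi(x_1, S y_1) x_2 y_2 psi(x_3, y_3)] is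
    evaluated on generators. These are group-like or skew-primitive, so the rule
    has at most nine terms, most of which vanish (lemmas [double_group_like],
    [double_skew_left], [double_skew_right], [double_skew_skew]). The
    coefficients are values of [psi] on generators, which the operators defining
    [phi] give directly; values at inverses and antipodes follow since a
    group-like element pairs multiplicatively and a skew-primitive one by a
    twisted Leibniz rule ([double_relations_hold]).

    No further relations hold. Let [Q] be [T] modulo the ideal of the relations
    and [q : T -> Q] the projection. The presentations of the halves give
    algebra morphisms [fA] and [fB] from the two halves to [Q], hence a linear
    map [M : U -> Q] with [M (x y) = fA(x) fB(y)], because [U] is the tensor
    product of the halves as a vector space. This map satisfies
    [M (g u) = q(g) M (u)] for each generator [g]: this is clear for a generator
    of the plus half, and for one of the minus half it is proved by moving it to
    the right past the plus generators one at a time; the exchange formula used is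
    a consequence of the relations ([straightening]), so it is the same in [U] and
    in [Q]. Hence [M o u = q] ([double_universal]), and [u z = 0] forces
    [q z = 0]. *)

(** * Free algebras *)

Section FreeAlgebra.
Variables (F : fieldType) (G : choiceType).
Local Notation T := (free_alg F G).

Lemma monomM (c d : F) (u w : {fmonom G}) :
  << c *g u >> * << d *g w >> = << c * d *g mmul u w >> :> T.
Proof.
by rewrite (malgMEw msuppU_le msuppU_le) !big_seq_fset1 !mcoeffUU.
Qed.

Lemma monomZ (c d : F) (w : {fmonom G}) :
  c *: << d *g w >> = << c * d *g w >> :> T.
Proof. by rewrite -mul_malgC monomM mul1m. Qed.

Lemma free_alg_ind (P : T -> Prop) :
    P 1 -> (forall g x, P x -> P (letter F g * x)) ->
    (forall c x y, P x -> P y -> P (c *: x + y)) ->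
  forall x, P x.
Proof.
move=> P1 PM PL x.
have P0 : P 0 by have := PL (-1) 1 1 P1 P1; rewrite scaleN1r addNr.
have Pw (w : {fmonom G}) : P << w >>.
  rewrite -[w]fmK; case: w => w /=; elim: w => [|g w IHw].
    by have -> : FMonom [::] = mone :> {fmonom G} by apply/val_inj; rewrite /= fm1.
  have -> : << FMonom (g :: w) >> = letter F g * << FMonom w >> :> T.
    rewrite monomM mulr1.
    by congr << _ >>; apply/val_inj; rewrite /= fmM fmU.
  exact: PM.
rewrite (monalgE x); elim: (enum_fset _) => [|k s IHs]; first by rewrite big_nil.
rewrite big_cons; have -> : << x@_k *g k >> = x@_k *: << k >> :> T.
  by rewrite monomZ mulr1.
exact: PL.
Qed.

Let central_scalar (A : lalgType F) (c : F) (a : A) := c *: a = a * c%:A.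

Let central_scalarM (A : lalgType F) c (a b : A) :
  central_scalar c a -> central_scalar c b -> central_scalar c (a * b).
Proof. by rewrite /central_scalar scalerAl => -> cb; rewrite -!mulrA mulr_algl cb. Qed.

Let central_scalarD (A : lalgType F) c d (a b : A) :
  central_scalar c a -> central_scalar c b -> central_scalar c (d *: a + b).
Proof.
rewrite /central_scalar => ca cb.
by rewrite scalerDr scalerA mulrC -scalerA ca cb mulrDl scalerAl.
Qed.

Let central_scalarP (A : lalgType F) c (a b : A) :
  central_scalar c a -> c *: (a * b) = a * (c *: b).
Proof. by rewrite /central_scalar scalerAl => ->; rewrite -mulrA mulr_algl. Qed.

(** A letter commutes with [c], as both products are [c] times one monomial; and
    commuting with [c] is stable under products and linear combinations. *)
Lemma free_scaleAr (c : F) (x y : T) : c *: (x * y) = x * (c *: y).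
Proof.
apply: central_scalarP.
elim/free_alg_ind: x => [|g x IHx|d x z IHx IHz].
- by rewrite /central_scalar mul1r.
- apply: central_scalarM IHx; rewrite /central_scalar -!mul_malgC.
  by rewrite mulr1 /letter [LHS]monomM [RHS]monomM mulrC mul1m mulm1.
- exact: central_scalarD.
Qed.

End FreeAlgebra.

Section Eval.
Variables (F : fieldType) (G : choiceType) (A : algType F) (h : G -> A).

Let word (w : {fmonom G}) : A := \prod_(g <- w) h g.

Let word_mmorphism : mmorphism word.
Proof. by split=> [u w|]; rewrite /word ?fmM ?big_cat // fm1 big_nil. Qed.

HB.instance Definition _ := isMultiplicative.Build {fmonom G} A word word_mmorphism.

Fact eval_zmod_morphism : zmod_morphism (eval h).
Proof. exact: mmapB. Qed.

Fact eval_monoid_morphism : monoid_morphism (eval h).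
Proof.
have [] := @commr_mmap_is_multiplicative _ _ _ (GRing.in_alg A) word.
  by move=> x u w; rewrite /GRing.comm mulr_algl mulr_algr.
by split.
Qed.

Fact eval_scalable : scalable (eval h).
Proof.
by move=> c x; rewrite /eval (mmapZ (h := word)) /= mulr_algl.
Qed.

HB.instance Definition _ :=
  GRing.isZmodMorphism.Build (free_alg F G) A (eval h) eval_zmod_morphism.
HB.instance Definition _ :=
  GRing.isMonoidMorphism.Build (free_alg F G) A (eval h) eval_monoid_morphism.
HB.instance Definition _ :=
  GRing.isScalable.Build F (free_alg F G) A *:%R (eval h) eval_scalable.

Lemma eval_letter g : eval h (letter F g) = h g.
Proof. by rewrite /eval mmapU /= fmU big_seq1 scale1r mul1r. Qed.

End Eval.

Lemma eval_unique (F : fieldType) (G : choiceType) (A : algType F)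
    (f : {lrmorphism free_alg F G -> A}) x :
  eval (fun g => f (letter F g)) x = f x.
Proof.
elim/free_alg_ind: x => [|g x IHx|c x y IHx IHy]; first by rewrite !rmorph1.
  by rewrite !rmorphM /= eval_letter IHx.
by rewrite !linearP /= IHx IHy.
Qed.

(** * Quotients by ideals *)

Section IdealTheory.
Variables (F : fieldType) (A : lalgType F) (S : A -> Prop).

Lemma ideal_genMl a x : ideal_gen S x -> ideal_gen S (a * x).
Proof. by move=> Sx; rewrite -[a * x]mulr1; apply: Ideal_mul. Qed.

Lemma ideal_genMr a x : ideal_gen S x -> ideal_gen S (x * a).
Proof. by move=> Sx; rewrite -[x]mul1r; apply: Ideal_mul. Qed.

Lemma ideal_genZ c x : ideal_gen S x -> ideal_gen S (c *: x).
Proof. by rewrite -mulr_algl; apply: ideal_genMl. Qed.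

Lemma ideal_genB x y : ideal_gen S x -> ideal_gen S y -> ideal_gen S (x - y).
Proof. by move=> Sx Sy; rewrite -scaleN1r; apply/Ideal_add/ideal_genZ. Qed.

Definition ideal_pred : {pred A} := fun x => `[< ideal_gen S x >].

Fact ideal_pred_zmod_closed : zmod_closed ideal_pred.
Proof.
split=> [|x y /asboolP Sx /asboolP Sy]; apply/asboolP; first exact: Ideal_0.
exact: ideal_genB.
Qed.

HB.instance Definition _ :=
  GRing.isZmodClosed.Build A ideal_pred ideal_pred_zmod_closed.

Hypothesis scaleAr : forall (c : F) (x y : A), c *: (x * y) = x * (c *: y).
Hypothesis S1 : ~ ideal_gen S 1.

(** The proofs are parameters of the type because the algebra structure, in
    particular [1 != 0], depends on them. *)
Definition quot_alg of (forall (c : F) (x y : A), c *: (x * y) = x * (c *: y))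
  & ~ ideal_gen S 1 : Type := Quotient.quot ideal_pred.

Local Notation Q := (quot_alg scaleAr S1).

HB.instance Definition _ := GRing.Zmodule.on Q.

Definition quot_class (x : A) : Q := (\pi_(Quotient.quot ideal_pred) x)%qT.
Local Notation pi := quot_class.

Lemma quot_class_eq x y : pi x = pi y <-> ideal_gen S (x - y).
Proof.
split=> [/eqP|Sxy]; first by rewrite -Quotient.idealrBE => /asboolP.
by apply/eqP; rewrite -Quotient.idealrBE; apply/asboolP.
Qed.

Lemma quot_class_surj (q : Q) : {x | q = pi x}.
Proof. by exists (repr q); rewrite /pi reprK. Qed.

Fact quot_class_zmod_morphism : zmod_morphism pi.
Proof. by move=> x y; rewrite /pi Quotient.pi_add Quotient.pi_opp. Qed.

HB.instance Definition _ :=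
  GRing.isZmodMorphism.Build A Q quot_class quot_class_zmod_morphism.

Definition quot_scale (c : F) (p : Q) : Q := pi (c *: repr p).
Definition quot_mul (p q : Q) : Q := pi (repr p * repr q).
Definition quot_one : Q := pi 1.

Let repr_pi x : ideal_gen S (repr (pi x) - x).
Proof. by apply/quot_class_eq; rewrite {1}/pi reprK. Qed.

Lemma quot_scaleE c x : quot_scale c (pi x) = pi (c *: x).
Proof. by apply/quot_class_eq; rewrite -scalerBr; apply/ideal_genZ/repr_pi. Qed.

Lemma quot_mulE x y : quot_mul (pi x) (pi y) = pi (x * y).
Proof.
apply/quot_class_eq; set x' := repr _; set y' := repr _.
have -> : x' * y' - x * y = (x' - x) * y' + x * (y' - y).
  by rewrite mulrBl mulrBr addrA subrK.
by apply: Ideal_add; [apply: ideal_genMr|apply: ideal_genMl]; apply: repr_pi.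
Qed.

Fact quot_mulA : associative quot_mul.
Proof.
move=> p q r; have [x ->] := quot_class_surj p; have [y ->] := quot_class_surj q.
by have [z ->] := quot_class_surj r; rewrite !quot_mulE mulrA.
Qed.

Fact quot_mul1l : left_id quot_one quot_mul.
Proof. by move=> p; have [x ->] := quot_class_surj p; rewrite quot_mulE mul1r. Qed.

Fact quot_mul1r : right_id quot_one quot_mul.
Proof. by move=> p; have [x ->] := quot_class_surj p; rewrite quot_mulE mulr1. Qed.

Fact quot_mulDl : left_distributive quot_mul +%R.
Proof.
move=> p q r; have [x ->] := quot_class_surj p; have [y ->] := quot_class_surj q.
by have [z ->] := quot_class_surj r; rewrite -raddfD !quot_mulE -raddfD mulrDl.
Qed.

Fact quot_mulDr : right_distributive quot_mul +%R.
Proof.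
move=> p q r; have [x ->] := quot_class_surj p; have [y ->] := quot_class_surj q.
by have [z ->] := quot_class_surj r; rewrite -raddfD !quot_mulE -raddfD mulrDr.
Qed.

Fact quot_one_neq0 : quot_one != 0.
Proof.
by apply/eqP; rewrite -(raddf0 pi) => /quot_class_eq; rewrite subr0.
Qed.

HB.instance Definition _ := GRing.Zmodule_isNzRing.Build Q
  quot_mulA quot_mul1l quot_mul1r quot_mulDl quot_mulDr quot_one_neq0.

Fact quot_scaleA c d p : quot_scale c (quot_scale d p) = quot_scale (c * d) p.
Proof. by have [x ->] := quot_class_surj p; rewrite !quot_scaleE scalerA. Qed.

Fact quot_scale1 : left_id 1 quot_scale.
Proof. by move=> p; have [x ->] := quot_class_surj p; rewrite quot_scaleE scale1r. Qed.

Fact quot_scaleDr : right_distributive quot_scale +%R.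
Proof.
move=> c p q; have [x ->] := quot_class_surj p; have [y ->] := quot_class_surj q.
by rewrite -raddfD !quot_scaleE -raddfD scalerDr.
Qed.

Fact quot_scaleDl p : {morph quot_scale^~ p : c d / c + d}.
Proof.
by move=> c d; have [x ->] := quot_class_surj p; rewrite !quot_scaleE -raddfD scalerDl.
Qed.

HB.instance Definition _ := GRing.Zmodule_isLmodule.Build F Q
  quot_scaleA quot_scale1 quot_scaleDr quot_scaleDl.

Fact quot_scaleAl (c : F) (p q : Q) : c *: (p * q) = (c *: p) * q.
Proof.
have [x ->] := quot_class_surj p; have [y ->] := quot_class_surj q.
rewrite -[LHS]/(quot_scale _ (quot_mul _ _)) -[RHS]/(quot_mul (quot_scale _ _) _).
by rewrite !(quot_mulE, quot_scaleE) scalerAl.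
Qed.

HB.instance Definition _ := GRing.Lmodule_isLalgebra.Build F Q quot_scaleAl.

Fact quot_scaleAr (c : F) (p q : Q) : c *: (p * q) = p * (c *: q).
Proof.
have [x ->] := quot_class_surj p; have [y ->] := quot_class_surj q.
rewrite -[LHS]/(quot_scale _ (quot_mul _ _)) -[RHS]/(quot_mul _ (quot_scale _ _)).
by rewrite !(quot_mulE, quot_scaleE) scaleAr.
Qed.

HB.instance Definition _ := GRing.Lalgebra_isAlgebra.Build F Q quot_scaleAr.

Fact quot_class_monoid_morphism : monoid_morphism quot_class.
Proof. by split=> // x y; rewrite -quot_mulE. Qed.

Fact quot_class_scalable : scalable quot_class.
Proof. by move=> c x; rewrite -quot_scaleE. Qed.

HB.instance Definition _ :=
  GRing.isMonoidMorphism.Build A Q quot_class quot_class_monoid_morphism.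
HB.instance Definition _ :=
  GRing.isScalable.Build F A Q *:%R quot_class quot_class_scalable.

End IdealTheory.

Lemma quotient_exists (F : fieldType) (A : lalgType F) (S : A -> Prop) :
    (forall (c : F) (x y : A), c *: (x * y) = x * (c *: y)) ->
    ~ ideal_gen S 1 ->
  exists (Q : algType F) (p : {lrmorphism A -> Q}), is_quotient p S.
Proof.
move=> ZA S1; exists (quot_alg ZA S1), (quot_class ZA S1); split=> [q|x].
  by have [x ->] := quot_class_surj q; exists x.
have := quot_class_eq ZA S1 x 0; rewrite subr0; apply: iff_trans.
by rewrite raddf0.
Qed.

Lemma ideal_gen_vanish (F : fieldType) (A B : lalgType F) (f : {lrmorphism A -> B})
    (S : A -> Prop) :
  (forall x, S x -> f x = 0) -> forall x, ideal_gen S x -> f x = 0.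
Proof.
move=> fS x; elim=> {x} [x /fS //||x y _ fx _ fy|a x b _ fx]; first exact: raddf0.
  by rewrite raddfD /= fx fy addr0.
by rewrite !rmorphM /= fx mulr0 mul0r.
Qed.

Lemma quotient_factor (F : fieldType) (A B C : lalgType F)
    (p : {lrmorphism A -> B}) (f : {lrmorphism A -> C}) (S : A -> Prop) :
    is_quotient p S -> (forall x, S x -> f x = 0) ->
  exists g : {lrmorphism B -> C}, forall x, g (p x) = f x.
Proof.
case=> surj ker fS.
pose s b := projT1 (cid (surj b)).
have ps b : p (s b) = b by rewrite /s; case: cid.
have fE x y : p x = p y -> f x = f y.
  move=> pxy; apply/eqP; rewrite -subr_eq0 -raddfB; apply/eqP.
  by apply: (ideal_gen_vanish fS); apply/ker; rewrite raddfB /= pxy subrr.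
pose g b := f (s b).
have g_zmod : zmod_morphism g.
  by move=> x y; rewrite /g -raddfB; apply: fE; rewrite !raddfB /= !ps.
have g_monoid : monoid_morphism g.
  split=> [|x y]; first by rewrite -[RHS](rmorph1 f); apply: fE; rewrite ps rmorph1.
  by rewrite /g -rmorphM; apply: fE; rewrite !rmorphM /= !ps.
have g_scale : scalable g.
  by move=> c x; rewrite /g -linearZ; apply: fE; rewrite linearZ /= !ps.
pose m1 := GRing.isZmodMorphism.Build B C g g_zmod.
pose m2 := GRing.isMonoidMorphism.Build B C g g_monoid.
pose m3 := GRing.isScalable.Build F B C *:%R g g_scale.
pose G : {lrmorphism B -> C} := HB.pack g m1 m2 m3.
by exists G => x; apply: fE; rewrite ps.
Qed.

Lemma presented_factor (F : fieldType) (G : choiceType) (A B : algType F)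
    (h : G -> A) (R : free_alg F G -> free_alg F G -> Prop) (k : G -> B) :
    presented_by h R -> (forall l r, R l r -> eval k l = eval k r) ->
  exists f : {lrmorphism A -> B}, forall x, f (eval h x) = eval k x.
Proof.
move=> hR kR.
have H := @quotient_factor F (free_alg F G) A B (eval h) (eval k) _ hR.
apply: H; by move=> _ [l [r [lr ->]]]; rewrite raddfB /= (kR _ _ lr) subrr.
Qed.

(** * Tensor products *)

Section TensorTheory.
Variables (F : fieldType) (A B : lmodType F).
Implicit Types (a : A) (b : B) (x : tens A B).

Fact pure_linearl b : linear (fun a => a ⊗ b).
Proof.
move=> c a a'; rewrite -[c *: (_ ⊗ _)]/(tens_scale _ _) pi_tens_scale -pi_tensD.
by apply/pi_tens_eq/Tens_null_l.
Qed.

Fact pure_linearr a : linear (fun b => a ⊗ b).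
Proof.
move=> c b b'; rewrite -[c *: (_ ⊗ _)]/(tens_scale _ _) pi_tens_scale -pi_tensD.
by apply/pi_tens_eq/Tens_null_r.
Qed.

HB.instance Definition _ a := GRing.isLinear.Build F B (tens A B) *:%R (pure a)
  (pure_linearr a).

Lemma pureDl a a' b : (a + a') ⊗ b = a ⊗ b + a' ⊗ b.
Proof. by have := pure_linearl b 1 a a'; rewrite !scale1r. Qed.

Lemma pure0l b : 0 ⊗ b = 0 :> tens A B.
Proof. by apply: (@addIr _ (0 ⊗ b)); rewrite -pureDl !add0r. Qed.

Lemma pureZl c a b : (c *: a) ⊗ b = c *: (a ⊗ b).
Proof. by have := pure_linearl b c a 0; rewrite pure0l !addr0. Qed.

Lemma pureDr a b b' : a ⊗ (b + b') = a ⊗ b + a ⊗ b'.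
Proof. exact: linearD. Qed.

Lemma pureZr c a b : a ⊗ (c *: b) = c *: (a ⊗ b).
Proof. exact: linearZ. Qed.

Lemma tens_ind (P : tens A B -> Prop) :
    (forall a b, P (a ⊗ b)) -> (forall x y, P x -> P y -> P (x + y)) ->
  forall x, P x.
Proof.
move=> Pp PD x; rewrite -[x]reprK; move: (repr x) => {}x.
have P0 : P 0 by rewrite -(pure0l 0); apply: Pp.
pose pi u : tens A B := (\pi_(Quotient.quot (@tens_null_pred F A B)) u)%qT.
have piD u w : pi (u + w) = pi u + pi w by exact: pi_tensD.
have pi0 : pi 0 = 0 by apply: (@addIr _ (pi 0)); rewrite -piD !add0r.
rewrite -/(pi x) (monalgE x).
elim: (enum_fset _) => [|[a b] s IHs]; first by rewrite big_nil pi0.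
rewrite big_cons piD; apply: PD => //.
rewrite (_ : << _ *g _ >> = x@_(a, b) *: << (a, b) >>); last first.
  by apply/malgP=> l; rewrite mcoeffZ !mcoeffU mulr_natr.
by rewrite /pi -pi_tens_scale -[tens_scale _ _]/(_ *: (a ⊗ b)) -pureZl.
Qed.

Section Lift.
Variables (V : lmodType F) (f : A -> B -> V) (fP : is_bilinear f).

Lemma tens_liftD x y : tens_lift f (x + y) = tens_lift f x + tens_lift f y.
Proof. by have := tens_lift_linear fP 1 x y; rewrite !scale1r. Qed.

End Lift.

(** The lift at [x] is a sum of values of the form, with the coefficients of a
    chosen representative of [x] as weights. *)
Lemma tens_lift_linear_param (V W : lmodType F) (f : W -> A -> B -> V) x :
    (forall a b, linear (fun w => f w a b)) -> linear (fun w => tens_lift (f w) x).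
Proof.
move=> fl c w w'; rewrite /tens_lift scaler_sumr -big_split /=.
by apply: eq_bigr => p _; rewrite fl scalerDr !scalerA mulrC.
Qed.

End TensorTheory.

Lemma tens_map_pure (F : fieldType) (A B C D : lmodType F)
    (f : {linear A -> C}) (g : {linear B -> D}) a b :
  tens_map f g (a ⊗ b) = f a ⊗ g b.
Proof.
rewrite /tens_map tens_lift_pure //; split=> [b' c x y|a' c x y] /=.
  by rewrite linearP pureDl pureZl.
by rewrite linearP pureDr pureZr.
Qed.

Lemma tens_mapD (F : fieldType) (A B C D : lmodType F)
    (f : {linear A -> C}) (g : {linear B -> D}) x y :
  tens_map f g (x + y) = tens_map f g x + tens_map f g y.
Proof.
apply: tens_liftD; split=> [b' c u w|a' c u w] /=.
  by rewrite linearP pureDl pureZl.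
by rewrite linearP pureDr pureZr.
Qed.

(** * The exchange rule of the double *)

Section Straighten.
Variables (F : fieldType) (A B : algType F) (HB : hopf_algebra B).
Variable psi : {bilinear A -> B -> F | *%R & *%R}.

(* The four nested lifts of [straighten], innermost first; each must be known to
   be linear in its parameters before the next one is a lift of a bilinear map. *)
Let step4 x1 x2 x3 (y12 : tens B B) y3 : tens A B :=
  tens_lift (fun y1 y2 =>
    (psi x1 (antipode HB y1) * psi x3 y3) *: (x2 ⊗ y2)) y12.
Let step3 x1 x2 x3 Y := tens_lift (step4 x1 x2 x3) Y.
Let step2 x12 x3 Y := tens_lift (fun x1 x2 => step3 x1 x2 x3 Y) x12.

Let linear4_1 x2 x3 y12 y3 : linear (fun x1 => step4 x1 x2 x3 y12 y3).
Proof.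
apply: tens_lift_linear_param => y1 y2 c u w.
by rewrite linearPl mulrDl scalerDl scalerA mulrA.
Qed.

Let linear4_2 x1 x3 y12 y3 : linear (fun x2 => step4 x1 x2 x3 y12 y3).
Proof.
apply: tens_lift_linear_param => y1 y2 c u w.
by rewrite pureDl pureZl scalerDr !scalerA mulrC.
Qed.

Let linear4_3 x1 x2 y12 y3 : linear (fun x3 => step4 x1 x2 x3 y12 y3).
Proof.
apply: tens_lift_linear_param => y1 y2 c u w.
by rewrite linearPl mulrDr scalerDl scalerA mulrCA.
Qed.

Let linear4_5 x1 x2 x3 y12 : linear (step4 x1 x2 x3 y12).
Proof.
apply: tens_lift_linear_param => y1 y2 c u w.
by rewrite linearPr mulrDr scalerDl scalerA mulrCA.
Qed.

Let form4_bilinear x1 x2 x3 y3 : is_bilinear (fun y1 y2 =>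
    (psi x1 (antipode HB y1) * psi x3 y3) *: (x2 ⊗ y2) : tens A B).
Proof.
split=> [y2 c u w|y1 c u w]; first by rewrite linearP linearPr mulrDl scalerDl scalerA mulrA.
by rewrite pureDr pureZr scalerDr !scalerA mulrC.
Qed.

Let form3_bilinear x1 x2 x3 : is_bilinear (step4 x1 x2 x3).
Proof.
split=> [y3|y12]; last exact: linear4_5.
exact: (tens_lift_linear (form4_bilinear x1 x2 x3 y3)).
Qed.

Let form2_bilinear x3 Y : is_bilinear (fun x1 x2 => step3 x1 x2 x3 Y).
Proof.
by split=> x; apply: tens_lift_linear_param => y12 y3;
  [apply: linear4_1|apply: linear4_2].
Qed.

Let form1_bilinear Y : is_bilinear (fun x12 x3 => step2 x12 x3 Y).
Proof.
split=> [x3|x12]; first exact: (tens_lift_linear (form2_bilinear x3 Y)).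
apply: tens_lift_linear_param => x1 x2; apply: tens_lift_linear_param => y12 y3.
exact: linear4_3.
Qed.

Lemma straightenDl X X' Y :
  straighten HB psi (X + X') Y = straighten HB psi X Y + straighten HB psi X' Y.
Proof. exact: (tens_liftD (form1_bilinear Y)). Qed.

Lemma straightenDr X Y Y' :
  straighten HB psi X (Y + Y') = straighten HB psi X Y + straighten HB psi X Y'.
Proof.
suff /(_ 1 Y Y') : linear (straighten HB psi X) by rewrite !scale1r.
apply: tens_lift_linear_param => x12 x3; apply: tens_lift_linear_param => x1 x2.
exact: (tens_lift_linear (form3_bilinear x1 x2 x3)).
Qed.

Lemma straighten_pure x1 x2 x3 y1 y2 y3 :
  straighten HB psi (x1 ⊗ x2 ⊗ x3) (y1 ⊗ y2 ⊗ y3)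
    = (psi x1 (antipode HB y1) * psi x3 y3) *: (x2 ⊗ y2).
Proof.
rewrite -[LHS]/(tens_lift (fun x12 x3 => step2 x12 x3 _) _).
rewrite (tens_lift_pure (form1_bilinear _)).
rewrite /step2 (tens_lift_pure (form2_bilinear _ _)).
rewrite /step3 (tens_lift_pure (form3_bilinear _ _ _)).
by rewrite /step4 (tens_lift_pure (form4_bilinear _ _ _ _)).
Qed.

(** The double coproduct of a skew-primitive element has three terms. *)
Lemma straighten_sum3l X1 X2 X3 Y z1 z2 z3 :
    straighten HB psi X1 Y = z1 -> straighten HB psi X2 Y = z2 ->
    straighten HB psi X3 Y = z3 ->
  straighten HB psi (X1 + X2 + X3) Y = z1 + z2 + z3.
Proof. by move=> <- <- <-; rewrite 2!straightenDl. Qed.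

Lemma straighten_sum3r X Y1 Y2 Y3 z1 z2 z3 :
    straighten HB psi X Y1 = z1 -> straighten HB psi X Y2 = z2 ->
    straighten HB psi X Y3 = z3 ->
  straighten HB psi X (Y1 + Y2 + Y3) = z1 + z2 + z3.
Proof. by move=> <- <- <-; rewrite 2!straightenDr. Qed.

End Straighten.

(** * Group-like and skew-primitive elements *)

Section HopfElements.
Variables (F : fieldType) (A : algType F) (H : hopf_algebra A).

Definition group_like (x : A) : Prop := comul H x = x ⊗ x /\ counit H x = 1.

(** [E_i] has this property for [(J_i, K_i)] and [F_i] for [(K'_i, J'_i)]. *)
Definition skew_primitive (p q x : A) : Prop :=
  [/\ group_like p, group_like q, comul H x = x ⊗ p + q ⊗ x & counit H x = 0].

Lemma antipode_mull x : group_like x -> antipode H x * x = 1.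
Proof.
case=> Dx ex; have := antipode_l H x; rewrite Dx ex scale1r tens_lift_pure //.
split=> [b c u w|a c u w] /=; last by rewrite mulrDr -scalerAr.
by rewrite linearP mulrDl -scalerAl.
Qed.

Lemma antipode_mulr x : group_like x -> x * antipode H x = 1.
Proof.
case=> Dx ex; have := antipode_r H x; rewrite Dx ex scale1r tens_lift_pure //.
split=> [b c u w|a c u w] /=; first by rewrite mulrDl -scalerAl.
by rewrite linearP mulrDr -scalerAr.
Qed.

Lemma comul2_group_like x : group_like x -> comul2 H x = x ⊗ x ⊗ x.
Proof. by case=> Dx _; rewrite /comul2 Dx tens_map_pure /= Dx. Qed.

Lemma comul2_skew_primitive p q x : skew_primitive p q x ->
  comul2 H x = x ⊗ p ⊗ p + q ⊗ x ⊗ p + q ⊗ q ⊗ x.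
Proof.
case=> -[Dp _] [Dq _] Dx _.
by rewrite /comul2 Dx tens_mapD !tens_map_pure /= Dx Dq pureDl.
Qed.

End HopfElements.

Section Pairing.
Variables (F : fieldType) (A B : algType F).
Variables (HA : hopf_algebra A) (HB : hopf_algebra B).
Variable psi : {bilinear A -> B -> F | *%R & *%R}.
Hypothesis psiP : skew_hopf_pairing HA HB psi.

Let psi_form_bilinear : forall x' x'',
  is_bilinear (fun y' y'' => psi x' y' * psi x'' y'' : F^o).
Proof.
move=> x' x''; split=> [y'' c u w|y' c u w] /=.
  by rewrite linearPr mulrDl -mulrA.
by rewrite linearPr mulrDr mulrCA.
Qed.

Let psi_pair_bilinear y' y'' : is_bilinear (fun x' x'' =>
  tens_lift (fun y' y'' => psi x' y' * psi x'' y'' : F^o) (y' ⊗ y'')).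
Proof.
split=> [x'' c u w|x' c u w]; rewrite !tens_lift_pure //.
  by rewrite linearPl mulrDl -mulrA.
by rewrite linearPl mulrDr mulrCA.
Qed.

Lemma pairing_group_likeM x y y' :
  group_like HA x -> psi x (y * y') = psi x y * psi x y'.
Proof.
case: psiP => _ psiM _ _ [Dx _].
by rewrite psiM Dx /pairing2 (tens_lift_pure (psi_pair_bilinear _ _)) tens_lift_pure.
Qed.

Lemma pairing_skew_primitiveM p q x y y' : skew_primitive HA p q x ->
  psi x (y * y') = psi x y * psi p y' + psi q y * psi x y'.
Proof.
case: psiP => _ psiM _ _ [_ _ Dx _].
rewrite psiM Dx /pairing2 (tens_liftD (psi_pair_bilinear _ _)).
by rewrite !(tens_lift_pure (psi_pair_bilinear _ _)) !tens_lift_pure.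
Qed.

Lemma pairing1r x : psi x 1 = counit HA x.
Proof. by case: psiP => -[]. Qed.

Lemma pairing_inv x y y' : group_like HA x -> y * y' = 1 -> psi x y' = (psi x y)^-1.
Proof.
move=> gx yy'; have : psi x y * psi x y' = 1.
  by rewrite -pairing_group_likeM // yy' pairing1r; case: gx.
move=> xy1; have xy0 : psi x y != 0.
  by apply/eqP=> xy0; move: xy1; rewrite xy0 mul0r => /esym/eqP; rewrite oner_eq0.
by apply: (mulfI xy0); rewrite xy1 mulfV.
Qed.

(** The value at the antipode of [y] is an inverse. *)
Lemma pairing_neq0 x y : group_like HA x -> group_like HB y -> psi x y != 0.
Proof.
move=> gx gy; apply/eqP=> xy0; have : psi x (y * antipode HB y) = 1.
  by rewrite antipode_mulr // pairing1r; case: gx.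
by rewrite pairing_group_likeM // xy0 mul0r => /esym/eqP; rewrite oner_eq0.
Qed.

Lemma pairing_antipode x y : group_like HA x -> group_like HB y ->
  psi x (antipode HB y) = (psi x y)^-1.
Proof. by move=> gx gy; apply: pairing_inv => //; apply: antipode_mulr. Qed.

(** Expand [0 = psi(x, 1) = psi(x, y * S y)] by the twisted Leibniz rule; the
    factor [psi(q, y)] is invertible. *)
Lemma pairing_skew_primitive_antipode p q x y :
    skew_primitive HA p q x -> group_like HB y -> psi x y = 0 ->
  psi x (antipode HB y) = 0.
Proof.
move=> px gy xy0; have [_ gq _ ex] := px.
have : psi x (y * antipode HB y) = 0 by rewrite antipode_mulr // pairing1r.
rewrite (pairing_skew_primitiveM _ _ px) xy0 mul0r add0r => /eqP.
by rewrite mulf_eq0 (negbTE (pairing_neq0 gq gy)) => /eqP.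
Qed.

End Pairing.

(** * Products in the double *)

Lemma linear_comb3 (F : fieldType) (V W : lmodType F) (f : {linear V -> W})
    a b c u v w :
  f (a *: u + b *: v + c *: w) = a *: f u + b *: f v + c *: f w.
Proof. by rewrite !linearD !linearZ. Qed.

Section Double.
Variables (F : fieldType) (A B : algType F).
Variables (HA : hopf_algebra A) (HB : hopf_algebra B).
Variable psi : {bilinear A -> B -> F | *%R & *%R}.
Hypothesis psiP : skew_hopf_pairing HA HB psi.
Variables (U : algType F) (t : {linear tens A B -> U}).
Hypothesis UP : is_drinfeld_double HA HB psi t.

Lemma double_span (u : U) : exists z, u = t z.
Proof. by case: UP => -[t' _ tK] _ _ _ _; exists (t' u); rewrite tK. Qed.

(** The element [t (1 (x) 1)] is a left unit on the products
    [t (x (x) 1) * t (1 (x) y)], which span the double. *)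
Lemma double1 : t (1 ⊗ 1) = 1.
Proof.
suff unitl u : t (1 ⊗ 1) * u = u by rewrite -[LHS]mulr1.
case: UP => _ tA _ tM _; have [z ->] := double_span u.
elim/tens_ind: z => [a b|z z' IHz IHz']; last by rewrite raddfD mulrDr IHz IHz'.
by rewrite -tM mulrA tA mul1r.
Qed.

Lemma double_morphisms : exists (eA : {lrmorphism A -> U}) (eB : {lrmorphism B -> U}),
  (forall x, eA x = t (x ⊗ 1)) /\ (forall y, eB y = t (1 ⊗ y)).
Proof.
case: UP => _ tA tB _ _.
pose eA x := t (x ⊗ 1); pose eB y := t (1 ⊗ y).
have eA_lin : linear eA by move=> c x y; rewrite /eA pureDl pureZl linearP.
have eB_lin : linear eB by move=> c x y; rewrite /eB pureDr pureZr linearP.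
have eA_monoid : monoid_morphism eA.
  by split=> [|x y]; [apply: double1|rewrite /eA tA].
have eB_monoid : monoid_morphism eB.
  by split=> [|x y]; [apply: double1|rewrite /eB tB].
pose mA1 := GRing.isLinear.Build F A U *:%R eA eA_lin.
pose mA2 := GRing.isMonoidMorphism.Build A U eA eA_monoid.
pose mB1 := GRing.isLinear.Build F B U *:%R eB eB_lin.
pose mB2 := GRing.isMonoidMorphism.Build B U eB eB_monoid.
pose fA : {lrmorphism A -> U} := HB.pack eA mA1 mA2.
pose fB : {lrmorphism B -> U} := HB.pack eB mB1 mB2.
by exists fA, fB.
Qed.

Lemma double_pure x y : t (x ⊗ y) = t (x ⊗ 1) * t (1 ⊗ y).
Proof. by case: UP. Qed.

Lemma double_cross x y : t (1 ⊗ y) * t (x ⊗ 1)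
  = t (straighten HB psi (comul2 HA x) (comul2 HB y)).
Proof. by case: UP. Qed.

Lemma double_group_like x y : group_like HA x -> group_like HB y ->
  t (1 ⊗ y) * t (x ⊗ 1) = t (x ⊗ 1) * t (1 ⊗ y).
Proof.
move=> gx gy; rewrite double_cross !comul2_group_like // straighten_pure.
by rewrite (pairing_antipode psiP) // mulVf ?(pairing_neq0 psiP) // scale1r double_pure.
Qed.

Lemma double_skew_left p q x y : skew_primitive HA p q x -> group_like HB y ->
    psi x y = 0 ->
  t (1 ⊗ y) * t (x ⊗ 1)
    = ((psi q y)^-1 * psi p y) *: (t (x ⊗ 1) * t (1 ⊗ y)).
Proof.
move=> px gy xy0; have [gp gq _ _] := px.
rewrite double_cross (comul2_skew_primitive px) comul2_group_like //.
rewrite (straighten_sum3l (straighten_pure _ _ _ _ _ _ _ _)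
  (straighten_pure _ _ _ _ _ _ _ _) (straighten_pure _ _ _ _ _ _ _ _)).
rewrite (pairing_skew_primitive_antipode psiP px) // (pairing_antipode psiP) //.
by rewrite xy0 mul0r mulr0 2!scale0r add0r addr0 linearZ double_pure.
Qed.

Lemma double_skew_right r s x y : group_like HA x -> skew_primitive HB r s y ->
    psi x y = 0 -> psi x (antipode HB y) = 0 ->
  t (1 ⊗ y) * t (x ⊗ 1)
    = ((psi x s)^-1 * psi x r) *: (t (x ⊗ 1) * t (1 ⊗ y)).
Proof.
move=> gx py xy0 xSy0; have [gr gs _ _] := py.
rewrite double_cross (comul2_skew_primitive py) comul2_group_like //.
rewrite (straighten_sum3r (straighten_pure _ _ _ _ _ _ _ _)
  (straighten_pure _ _ _ _ _ _ _ _) (straighten_pure _ _ _ _ _ _ _ _)).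
rewrite xSy0 xy0 (pairing_antipode psiP) //.
by rewrite mul0r mulr0 2!scale0r add0r addr0 linearZ double_pure.
Qed.

(** Of the nine terms of the exchange rule the three diagonal ones survive. *)
Lemma double_skew_skew p q r s x y :
    skew_primitive HA p q x -> skew_primitive HB r s y ->
    psi x r = 0 -> psi x s = 0 -> psi p y = 0 -> psi q (antipode HB y) = 0 ->
  t (1 ⊗ y) * t (x ⊗ 1)
    = (psi x (antipode HB y) * psi p r) *: (t (p ⊗ 1) * t (1 ⊗ r))
      + ((psi q s)^-1 * psi p r) *: (t (x ⊗ 1) * t (1 ⊗ y))
      + ((psi q s)^-1 * psi x y) *: (t (q ⊗ 1) * t (1 ⊗ s)).
Proof.
move=> px py xr0 xs0 py0 qSy0; have [gp gq _ _] := px; have [gr gs _ _] := py.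
rewrite double_cross (comul2_skew_primitive px) (comul2_skew_primitive py).
have row y1 y2 y3 := straighten_sum3l (straighten_pure HB psi x p p y1 y2 y3)
  (straighten_pure HB psi q x p y1 y2 y3) (straighten_pure HB psi q q x y1 y2 y3).
rewrite (straighten_sum3r (row _ _ _) (row _ _ _) (row _ _ _)).
rewrite (pairing_skew_primitive_antipode psiP px gs xs0) xr0 py0 qSy0.
rewrite (pairing_antipode psiP gq gs) !(mul0r, mulr0).
have drop0 (V : lmodType F) a b c (u v w z1 z2 z3 z4 z5 z6 : V) :
    a *: u + 0 *: z1 + 0 *: z2 + (0 *: z3 + b *: v + 0 *: z4)
      + (0 *: z5 + 0 *: z6 + c *: w) = a *: u + b *: v + c *: w.
  by rewrite !scale0r !add0r !addr0.
rewrite drop0 -(double_pure p r) -(double_pure x y) -(double_pure q s).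
exact: linear_comb3.
Qed.

End Double.

(** * The form phi on generators *)

Section Forms.
Variables (F : fieldType) (I : finType) (P : parameters F I).

Lemma mult_bilinear0l (b : lattice I -> lattice I -> F) nu :
  mult_bilinear b -> b 0 nu = 1.
Proof.
by case=> b0 bl _; apply: (mulfI (b0 0 nu)); rewrite -bl addr0 mulr1.
Qed.

Lemma mult_bilinear0r (b : lattice I -> lattice I -> F) mu :
  mult_bilinear b -> b mu 0 = 1.
Proof.
by case=> b0 _ br; apply: (mulfI (b0 mu 0)); rewrite -br addr0 mulr1.
Qed.

Lemma bracket0r mu : bracket P mu 0 = 1.
Proof.
rewrite /bracket (mult_bilinear0r _ (beta_mult P)) (mult_bilinear0l _ (xi_mult P)).
suff -> : dot (datum P) mu 0 = 0 by rewrite oppr0 !mulr1.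
by apply: (@addrI _ (dot (datum P) mu 0)); rewrite dotC -dotDl !addr0.
Qed.

Lemma word_degree1 : word_degree (mone : {fmonom I}) = 0.
Proof. by rewrite /word_degree fm1 big_nil. Qed.

Lemma homogeneous1 : homogeneous (1 : free_alg F I) 0.
Proof.
by move=> w; rewrite msuppU1 in_fset1 => /eqP ->; apply: word_degree1.
Qed.

Lemma homogeneous_letter (i : I) : homogeneous (letter F i) (simple i).
Proof.
by move=> w; rewrite /letter msuppU1 in_fset1 => /eqP ->;
  rewrite /word_degree fmU big_seq1.
Qed.

End Forms.

Section TorusMonomials.
Variables (F : fieldType) (I : finType) (A : algType F) (g : half_gen I -> A).

Let prod_simple (x y : I -> A) i :
  \prod_(j : I) zpower (x j) (y j) (simple i j) = x i.
Proof.
rewrite -[RHS](big_pred1_eq *%R i x) big_mkcond.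
apply: eq_bigr => j _; rewrite /simple ffunE /=.
by case: eqP => [->|_]; rewrite ?expr1 ?expr0.
Qed.

Let prod0 (x y : I -> A) : \prod_(j : I) zpower (x j) (y j) ((0 : lattice I) j) = 1.
Proof. by rewrite big1 // => j _; rewrite ffunE. Qed.

Lemma K_simple i : K_ g (simple i) = g (HK true i).
Proof. exact: prod_simple. Qed.

Lemma J_simple i : J_ g (simple i) = g (HJ true i).
Proof. exact: prod_simple. Qed.

Lemma K_0 : K_ g 0 = 1. Proof. exact: prod0. Qed.

Lemma J_0 : J_ g 0 = 1. Proof. exact: prod0. Qed.

End TorusMonomials.

Section PhiOnGenerators.
Variables (F : fieldType) (I : finType) (P : parameters F I).
Variables (Ap Am : algType F) (gp : half_gen I -> Ap) (gm : half_gen I -> Am).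
Variables (HAm : hopf_algebra Am) (HAmP : minus_hopf_spec gm HAm).
Variables (phi : Ap -> Am -> F) (phiP : is_phi P gp gm HAm phi).
Local Notation "⟨ i , j ⟩" := (bracket P (simple i) (simple j)).
Local Notation ξ i j := (xi P (simple i) (simple j)).

Let counitK i : counit HAm (gm (HK true i)) = 1.
Proof. by case: HAmP => /(_ (HK true i) erefl) []. Qed.

Let counitJ i : counit HAm (gm (HJ true i)) = 1.
Proof. by case: HAmP => /(_ (HJ true i) erefl) []. Qed.

Let counitF i : counit HAm (gm (HX i)) = 0.
Proof. by case: HAmP. Qed.

(* The operators [calK] and [calJ] are known on monomials [K'_tau1 x J'_tau2]. *)
Let monomK j : gm (HK true j) = K_ gm (simple j) * eval (fun i => gm (HX i)) 1 * J_ gm 0.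
Proof. by rewrite K_simple J_0 rmorph1 !mulr1. Qed.

Let monomJ j : gm (HJ true j) = K_ gm 0 * eval (fun i => gm (HX i)) 1 * J_ gm (simple j).
Proof. by rewrite K_0 J_simple rmorph1 !mul1r. Qed.

Let monomF j : gm (HX j)
  = K_ gm 0 * eval (fun i => gm (HX i)) (letter F j) * J_ gm 0.
Proof. by rewrite K_0 J_0 eval_letter mul1r mulr1. Qed.

(** [rho K_i] scales each generator of the minus half. *)
Lemma phi_K i j :
  [/\ phi (gp (HK true i)) (gm (HK true j)) = ⟨i, j⟩,
      phi (gp (HK true i)) (gm (HJ true j)) = 1
    & phi (gp (HK true i)) (gm (HX j)) = 0].
Proof.
case: phiP => calK [calJ [S [rho [[calKE _ _ _ _] [_ _ _ rhoK _] phiE]]]].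
rewrite !phiE -!(K_simple gp) !rhoK; split.
- rewrite {1}monomK (calKE _ _ _ _ _ (@homogeneous1 F I)) bracket0r mulr1.
  by rewrite -monomK linearZ /= counitK mulr1.
- rewrite {1}monomJ (calKE _ _ _ _ _ (@homogeneous1 F I)) bracket0r mulr1.
  by rewrite -monomJ linearZ /= counitJ mulr1.
- rewrite {1}monomF (calKE _ _ _ _ _ (@homogeneous_letter F I j)).
  by rewrite -monomF linearZ /= counitF mulr0.
Qed.

Lemma phi_J i j :
  [/\ phi (gp (HJ true i)) (gm (HK true j)) = ξ j i,
      phi (gp (HJ true i)) (gm (HJ true j)) = 1
    & phi (gp (HJ true i)) (gm (HX j)) = 0].
Proof.
case: phiP => calK [calJ [S [rho [[_ calJE _ _ _] [_ _ _ _ rhoJ] phiE]]]].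
rewrite !phiE -!(J_simple gp) !rhoJ.
have xi0 := mult_bilinear0l (simple i) (xi_mult P); split.
- rewrite {1}monomK (calJE _ _ _ _ _ (@homogeneous1 F I)) xi0 mulr1.
  by rewrite -monomK linearZ /= counitK mulr1.
- rewrite {1}monomJ (calJE _ _ _ _ _ (@homogeneous1 F I)) xi0 mulr1.
  by rewrite -monomJ linearZ /= counitJ mulr1.
- rewrite {1}monomF (calJE _ _ _ _ _ (@homogeneous_letter F I j)).
  by rewrite -monomF linearZ /= counitF mulr0.
Qed.

(** [rho E_i] is a multiple of the skew derivation [S i], which kills the torus and
    sends [F_j] to a scalar. *)
Lemma phi_E i j :
  [/\ phi (gp (HX i)) (gm (HK true j)) = 0,
      phi (gp (HX i)) (gm (HJ true j)) = 0
    & phi (gp (HX i)) (gm (HX j))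
        = if i == j then ((v_ P i)^-1 - v_ P i)^-1 * ξ i i else 0].
Proof.
case: phiP => calK [calJ [S [rho [[_ _ S0 SF _] [_ _ rhoE _ _] phiE]]]].
have SK : S i (gm (HK true j)) = 0.
  by rewrite -[RHS](S0 i (simple j) 0) K_simple J_0 mulr1.
have SJ : S i (gm (HJ true j)) = 0.
  by rewrite -[RHS](S0 i 0 (simple j)) J_simple K_0 mul1r.
rewrite !phiE !rhoE SK SJ SF !linearZ /= linear0 mulr0; split=> //.
rewrite rmorph1 mulr1 eq_sym; case: eqP => [->|_] //; exact: mulr0.
Qed.

End PhiOnGenerators.

(** * Relations as equations between images of generators *)

Section Relations.
Variables (F : fieldType) (I : finType).

Section Half.
Variables (cK cJ : I -> I -> F).

(** The relations of one half, in a form that passes through morphisms. *)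
Record half_rels (B : algType F) (k : half_gen I -> B) : Prop := HalfRels {
  half_comm : forall g h, is_torus g -> is_torus h -> k g * k h = k h * k g;
  half_invK : forall s i, k (HK s i) * k (HK (~~ s) i) = 1;
  half_invJ : forall s i, k (HJ s i) * k (HJ (~~ s) i) = 1;
  half_KX : forall i j,
    k (HK true i) * k (HX j) = cK i j *: (k (HX j) * k (HK true i));
  half_JX : forall i j,
    k (HJ true i) * k (HX j) = cJ i j *: (k (HX j) * k (HJ true i)) }.

Lemma half_relsP (B : algType F) (k : half_gen I -> B) : half_rels k <->
  forall l r, half_relation cK cJ l r -> eval k l = eval k r.
Proof.
have e2 g h : eval k (letter F g * letter F h) = k g * k h.
  by rewrite rmorphM /= !eval_letter.
have e3 g h l : eval k (letter F g * letter F h * letter F l) = k g * k h * k l.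
  by rewrite rmorphM /= e2 eval_letter.
have eZ c g : eval k (c *: letter F g) = c *: k g.
  by rewrite linearZ /= eval_letter.
split=> [[kC kK kJ kKX kJX] _ _ [g h Tg Th|s i|s i|i j|i j]|kR].
- by rewrite !e2 kC.
- by rewrite e2 kK rmorph1.
- by rewrite e2 kJ rmorph1.
- by rewrite e3 eZ kKX -scalerAl -mulrA (kK true) mulr1.
- by rewrite e3 eZ kJX -scalerAl -mulrA (kJ true) mulr1.
have kK s i : k (HK s i) * k (HK (~~ s) i) = 1.
  by rewrite -e2 (kR _ _ (Half_invK _ _ _ _)) rmorph1.
have kJ s i : k (HJ s i) * k (HJ (~~ s) i) = 1.
  by rewrite -e2 (kR _ _ (Half_invJ _ _ _ _)) rmorph1.
split=> // [g h Tg Th|i j|i j]; first by rewrite -!e2; apply/kR/Half_comm.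
  rewrite scalerAl -eZ -(kR _ _ (Half_KX _ _ _ _)) e3.
  by rewrite -!mulrA (kK false) mulr1.
rewrite scalerAl -eZ -(kR _ _ (Half_JX _ _ _ _)) e3.
by rewrite -!mulrA (kJ false) mulr1.
Qed.

Lemma half_rels_morph (B C : algType F) (f : {lrmorphism B -> C}) k :
  half_rels k -> half_rels (fun g => f (k g)).
Proof.
case=> kC kK kJ kKX kJX; split=> [g h Tg Th|s i|s i|i j|i j];
  rewrite -!(rmorphM f) /= ?(kC g h Tg Th) ?kK ?kJ ?rmorph1 //.
  by rewrite kKX linearZ.
by rewrite kJX linearZ.
Qed.

End Half.

Variable P : parameters F I.

Section Serre.
Variables (B : lalgType F) (i j : I).

Definition serre_sum (x y : B) : B :=
  \sum_(k < (serre_len P i j).+1) serre_coef P i j k *: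
    (divpow P i x k * y * divpow P i x (serre_len P i j - k)).

Definition serre_sum_op (x y : B) : B :=
  \sum_(k < (serre_len P i j).+1) serre_coef P i j k *:
    (divpow P i x (serre_len P i j - k) * y * divpow P i x k).

End Serre.

Lemma divpow_morph (B C : lalgType F) (f : {lrmorphism B -> C}) i x n :
  f (divpow P i x n) = divpow P i (f x) n.
Proof. by rewrite /divpow linearZ /= rmorphXn. Qed.

Lemma serre_sum_morph (B C : lalgType F) (f : {lrmorphism B -> C}) i j x y :
  f (serre_sum i j x y) = serre_sum i j (f x) (f y).
Proof.
rewrite /serre_sum linear_sum; apply: eq_bigr => k _.
by rewrite linearZ /= !rmorphM /= !divpow_morph.
Qed.

Lemma serre_sum_op_morph (B C : lalgType F) (f : {lrmorphism B -> C}) i j x y :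
  f (serre_sum_op i j x y) = serre_sum_op i j (f x) (f y).
Proof.
rewrite /serre_sum_op linear_sum; apply: eq_bigr => k _.
by rewrite linearZ /= !rmorphM /= !divpow_morph.
Qed.

Lemma eval_D (B : algType F) (h : I -> B) i j :
  eval h (D_ P i j) = serre_sum i j (h i) (h j).
Proof. by rewrite (serre_sum_morph (eval h)) /= !eval_letter. Qed.

(** Both sides are linear in [D_ij], so this is the reversal of the words
    [theta_i ^ k * theta_j * theta_i ^ k']. *)
Lemma anti_eval_D (B : algType F) (h : I -> B) i j :
  anti_eval h (D_ P i j) = serre_sum_op i j (h i) (h j).
Proof.
have letterX m : letter F i ^+ m = << FMonom (nseq m i) >> :> free_alg F I.
  elim: m => [|m IHm].
    by rewrite expr0; congr << _ >>; apply/val_inj; rewrite /= fm1.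
  rewrite exprS IHm /letter monomM mulr1; congr << _ >>.
  by apply/val_inj; rewrite /= fmM fmU.
rewrite /anti_eval /D_ raddf_sum; apply: eq_bigr => k _.
set n := (serre_len P i j - k)%N.
have -> : divpow P i (letter F i) k * letter F j * divpow P i (letter F i) n
  = << (qfact (v_ P i) k)^-1 * (qfact (v_ P i) n)^-1
       *g FMonom (nseq k i ++ j :: nseq n i) >> :> free_alg F I.
  rewrite /divpow !letterX.
  rewrite 2!monomZ /letter 2!monomM !mulr1; congr << _ *g _ >>.
  by apply/val_inj; rewrite /= !fmM fmU /= -catA.
rewrite monomZ /= mmapU /= rev_cat rev_cons !rev_nseq cat_rcons.
rewrite big_cat big_cons !big_nseq -!/(_ ^+ _) mulr_algl /divpow /=.
have iterE (x : B) m : iter m ( *%R x) 1 = x ^+ m.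
  by elim: m => //= m ->; rewrite exprS.
rewrite !iterE -!scalerAl -scalerAr !scalerA mulrA; congr (_ *: _).
by rewrite [X in _ * X]mulrC mulrA.
Qed.

Local Notation "⟨ i , j ⟩" := (bracket P (simple i) (simple j)).
Local Notation ξ i j := (xi P (simple i) (simple j)).

(** Besides restating the relations in a target algebra, this sorts them: the
    first two fields say that each half, short of its Serre relations, maps to
    [B]. *)
Record double_rels (B : algType F) (k : double_gen I -> B) : Prop := DoubleRels {
  double_plus : half_rels (fun i j => ⟨i, j⟩) (fun i j => ξ j i)
    (fun g => k (inl g));
  double_minus : half_rels (fun i j => ⟨j, i⟩ * (ξ i j)^-1) (fun i j => 1)
    (fun g => k (inr g));
  double_comm : forall g h, is_torus g -> is_torus h ->
    k (inr h) * k (inl g) = k (inl g) * k (inr h);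
  double_K'E : forall i j, k (inr (HK true i)) * k (inl (HX j))
    = (⟨j, i⟩^-1 * ξ i j) *: (k (inl (HX j)) * k (inr (HK true i)));
  double_J'E : forall i j, k (inr (HJ true i)) * k (inl (HX j))
    = k (inl (HX j)) * k (inr (HJ true i));
  double_KF : forall i j, k (inl (HK true i)) * k (inr (HX j))
    = ⟨i, j⟩^-1 *: (k (inr (HX j)) * k (inl (HK true i)));
  double_JF : forall i j, k (inl (HJ true i)) * k (inr (HX j))
    = (ξ j i)^-1 *: (k (inr (HX j)) * k (inl (HJ true i)));
  double_EF : forall i j,
    k (inl (HX i)) * k (inr (HX j)) - (ξ j i)^-1 *: (k (inr (HX j)) * k (inl (HX i)))
    = if i == j then (v_ P i - (v_ P i)^-1)^-1 *:
        (k (inl (HK true i)) * k (inr (HJ true i))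
         - k (inl (HJ true i)) * k (inr (HK true i))) else 0;
  double_serreE : forall i j, i != j ->
    serre_sum i j (k (inl (HX i))) (k (inl (HX j))) = 0;
  double_serreF : forall i j, i != j ->
    serre_sum_op i j (k (inr (HX i))) (k (inr (HX j))) = 0 }.

Lemma double_relsP (B : algType F) (k : double_gen I -> B) : double_rels k <->
  forall l r, double_relation P l r -> eval k l = eval k r.
Proof.
have e2 g h : eval k (letter F g * letter F h) = k g * k h.
  by rewrite rmorphM /= !eval_letter.
have eZ c g h : eval k (c *: (letter F g * letter F h)) = c *: (k g * k h).
  by rewrite linearZ /= e2.
have eEF i j : eval k (letter F (inl (HX i)) * letter F (inr (HX j))
    - (ξ j i)^-1 *: (letter F (inr (HX j)) * letter F (inl (HX i))))
  = k (inl (HX i)) * k (inr (HX j))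
    - (ξ j i)^-1 *: (k (inr (HX j)) * k (inl (HX i))).
  by rewrite raddfB /= e2 eZ.
have eKJ c i j : eval k (if i == j then c *:
      (letter F (inl (HK true i)) * letter F (inr (HJ true i))
       - letter F (inl (HJ true i)) * letter F (inr (HK true i))) else 0)
  = if i == j then c *: (k (inl (HK true i)) * k (inr (HJ true i))
      - k (inl (HJ true i)) * k (inr (HK true i))) else 0.
  by case: eqP => _; [rewrite linearZ /= raddfB /= !e2|apply: raddf0].
have eS i j x y : eval k (serre_sum i j (letter F x) (letter F y))
    = serre_sum i j (k x) (k y).
  by rewrite (serre_sum_morph (eval k)) /= !eval_letter.
have eSop i j x y : eval k (serre_sum_op i j (letter F x) (letter F y))
    = serre_sum_op i j (k x) (k y).
  by rewrite (serre_sum_op_morph (eval k)) /= !eval_letter.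
split=> [kP l r|kR].
  case: kP => -[pC pK pJ pKX pJX] [mC mK mJ mKX mJX] kC kK'E kJ'E kKF kJF kEF kSE kSF.
  have rel g h g' h' : k g * k h = k g' * k h' ->
      eval k (letter F g * letter F h) = eval k (letter F g' * letter F h').
    by rewrite !e2.
  have relZ g h g' h' c : k g * k h = c *: (k g' * k h') ->
      eval k (letter F g * letter F h) = eval k (c *: (letter F g' * letter F h')).
    by rewrite eZ e2.
  have rel1 g h : k g * k h = 1 -> eval k (letter F g * letter F h) = eval k 1.
    by rewrite rmorph1 e2.
  case=> {l r} [[g|g] [h|h] Tg Th|s i|s i|s i|s i|i j|i j|i j|i j|i j|i j|i j|i j|i j
    |i j ij|i j ij].
  - exact/rel/pC.
  - exact/rel/esym/kC.
  - exact/rel/kC.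
  - exact/rel/mC.
  - exact/rel1/pK.
  - exact/rel1/mK.
  - exact/rel1/pJ.
  - exact/rel1/mJ.
  - exact/relZ/pKX.
  - exact/relZ/kK'E.
  - exact/relZ/kKF.
  - exact/relZ/mKX.
  - exact/relZ/pJX.
  - exact/rel/kJ'E.
  - exact/relZ/kJF.
  - by apply: rel; rewrite mJX scale1r.
  - exact: etrans (eEF i j) (etrans (kEF i j) (esym (eKJ _ i j))).
  - exact: etrans (eS i j _ _) (etrans (kSE i j ij) (esym (raddf0 _))).
  - exact: etrans (eSop i j _ _) (etrans (kSF i j ij) (esym (raddf0 _))).
have rel g h g' h' : double_relation P (letter F g * letter F h)
    (letter F g' * letter F h') -> k g * k h = k g' * k h'.
  by rewrite -!e2 => /kR.
have relZ g h g' h' c : double_relation P (letter F g * letter F h)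
    (c *: (letter F g' * letter F h')) -> k g * k h = c *: (k g' * k h').
  by rewrite -eZ -e2 => /kR.
have rel1 g h : double_relation P (letter F g * letter F h) 1 -> k g * k h = 1.
  by rewrite -(rmorph1 (eval k)) -e2 => /kR.
split.
- split=> [g h Tg Th|s i|s i|i j|i j].
  + exact/rel/Torus_comm.
  + exact/rel1/Torus_K.
  + exact/rel1/Torus_J.
  + exact/relZ/Act_KE.
  + exact/relZ/Act_JE.
- split=> [g h Tg Th|s i|s i|i j|i j].
  + exact/rel/Torus_comm.
  + exact/rel1/Torus_K'.
  + exact/rel1/Torus_J'.
  + exact/relZ/Act_K'F.
  + by rewrite scale1r; apply/rel/Act_J'F.
- by move=> g h Tg Th; apply/rel/Torus_comm.
- by move=> i j; apply/relZ/Act_K'E.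
- by move=> i j; apply/rel/Act_J'E.
- by move=> i j; apply/relZ/Act_KF.
- by move=> i j; apply/relZ/Act_JF.
- move=> i j; exact: etrans (esym (eEF i j)) (etrans (kR _ _ (Cross P i j)) (eKJ _ i j)).
- move=> i j ij.
  exact: etrans (esym (eS i j _ _)) (etrans (kR _ _ (Serre_E P ij)) (raddf0 _)).
- move=> i j ij.
  exact: etrans (esym (eSop i j _ _)) (etrans (kR _ _ (Serre_F P ij)) (raddf0 _)).
Qed.

End Relations.

(** * The relations hold in the double *)

Lemma presented_rel (F : fieldType) (G : choiceType) (A : algType F)
    (h : G -> A) (R : free_alg F G -> free_alg F G -> Prop) l r :
  presented_by h R -> R l r -> eval h l = eval h r.
Proof.
case=> _ ker lr; apply/eqP; rewrite -subr_eq0 -raddfB; apply/eqP.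
by apply/ker/Ideal_gen; exists l, r.
Qed.

Definition double_generators (F : fieldType) (I : Type) (A B U : algType F)
    (t : tens A B -> U) (x : half_gen I -> A) (y : half_gen I -> B)
    (g : half_gen I + half_gen I) : U :=
  match g with inl h => t (x h ⊗ 1) | inr h => t (1 ⊗ y h) end.

Lemma hopf_morphism_group_like (F : fieldType) (A B : algType F)
    (HA : hopf_algebra A) (HB : hopf_algebra B) (f : {lrmorphism A -> B}) x :
  hopf_morphism HA HB f -> group_like HA x -> group_like HB (f x).
Proof. by case=> fD fe _ [Dx ex]; split; rewrite ?fe // fD Dx tens_map_pure. Qed.

Lemma hopf_morphism_skew_primitive (F : fieldType) (A B : algType F)
    (HA : hopf_algebra A) (HB : hopf_algebra B) (f : {lrmorphism A -> B}) p q x :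
  hopf_morphism HA HB f -> skew_primitive HA p q x ->
  skew_primitive HB (f p) (f q) (f x).
Proof.
move=> fH [gp gq Dx ex]; have [fD fe _] := fH.
split; [exact: hopf_morphism_group_like gp|exact: hopf_morphism_group_like gq| |].
  by rewrite fD Dx tens_mapD !tens_map_pure.
by rewrite fe.
Qed.

(** Solves the exchange rule for [E_i F_i - xi^-1 F_i E_i]: [e] stands for
    [E_i F_i], [jk] for [J_i K'_i], [kj] for [K_i J'_i], and the sum in
    parentheses is the value of [F_i E_i] found by that rule. *)
Lemma cross_combination (F : fieldType) (V : lmodType F) (z c : F) (e jk kj : V) :
    z != 0 ->
  e - z^-1 *: (((c - c^-1)^-1 * z) *: jk + z *: e + ((c^-1 - c)^-1 * z) *: kj)
    = (c - c^-1)^-1 *: (kj - jk).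
Proof.
move=> z0; have -> : (c^-1 - c)^-1 = - (c - c^-1)^-1 by rewrite -invrN opprB.
set a := (c - c^-1)^-1.
have zK k : z^-1 * (k * z) = k by rewrite mulrC mulfK.
rewrite !scalerDr !scalerA !zK mulVf // scale1r scaleNr opprB opprD.
by rewrite addrCA [e + _]addrCA subrr addr0 scalerN.
Qed.

Section DoubleRelationsHold.
Variables (F : fieldType) (I : finType) (P : parameters F I).
Variables (Ap Am : algType F) (gp : half_gen I -> Ap) (gm : half_gen I -> Am).
Hypothesis presAp : presented_by gp (plus_relation P).
Hypothesis presAm : presented_by gm (minus_relation P).
Variables (HAp : hopf_algebra Ap) (HAm : hopf_algebra Am).
Hypothesis HApP : plus_hopf_spec gp HAp.
Hypothesis HAmP : minus_hopf_spec gm HAm.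
Variable phi : Ap -> Am -> F.
Hypothesis phiP : is_phi P gp gm HAm phi.
Variables (fp fm : algType F).
Variables (pip : {lrmorphism Ap -> fp}) (pim : {lrmorphism Am -> fm}).
Hypothesis pipP : is_quotient pip (plus_serre P gp).
Hypothesis pimP : is_quotient pim (minus_serre P gm).
Variables (Hfp : hopf_algebra fp) (Hfm : hopf_algebra fm).
Hypothesis pipH : hopf_morphism HAp Hfp pip.
Hypothesis pimH : hopf_morphism HAm Hfm pim.
Variable psi : {bilinear fp -> fm -> F | *%R & *%R}.
Hypothesis psi_phi : forall x y, psi (pip x) (pim y) = phi x y.
Hypothesis psiP : skew_hopf_pairing Hfp Hfm psi.
Variables (U : algType F) (t : {linear tens fp fm -> U}).
Hypothesis UP : is_drinfeld_double Hfp Hfm psi t.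

Local Notation "⟨ i , j ⟩" := (bracket P (simple i) (simple j)).
Local Notation ξ i j := (xi P (simple i) (simple j)).

Let x_ (g : half_gen I) : fp := pip (gp g).
Let y_ (g : half_gen I) : fm := pim (gm g).

Let plus_rels := (half_relsP _ _ gp).2 (fun l r => presented_rel presAp (r := r)).
Let minus_rels := (half_relsP _ _ gm).2 (fun l r => presented_rel presAm (r := r)).

Let plus_group_like g : is_torus g -> group_like Hfp (x_ g).
Proof. by case: HApP => gl _ _ _ Tg; apply: (hopf_morphism_group_like pipH); apply: gl. Qed.

Let minus_group_like g : is_torus g -> group_like Hfm (y_ g).
Proof. by case: HAmP => gl _ _ _ Tg; apply: (hopf_morphism_group_like pimH); apply: gl. Qed.

Let skew_E i :
  skew_primitive Hfp (x_ (HJ true i)) (x_ (HK true i)) (x_ (HX i)).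
Proof.
case: HApP => gl DE eE _; apply: (hopf_morphism_skew_primitive pipH).
by split; [exact: gl|exact: gl|exact: DE|exact: eE].
Qed.

Let skew_F i :
  skew_primitive Hfm (y_ (HK true i)) (y_ (HJ true i)) (y_ (HX i)).
Proof.
case: HAmP => gl DF eF _; apply: (hopf_morphism_skew_primitive pimH).
split; [exact: gl|exact: gl|rewrite DF; exact: addrC|exact: eF].
Qed.

Let y_KV i : y_ (HK true i) * y_ (HK false i) = 1.
Proof. by rewrite /y_ -rmorphM /= (half_invK minus_rels true) rmorph1. Qed.

Let y_JV i : y_ (HJ true i) * y_ (HJ false i) = 1.
Proof. by rewrite /y_ -rmorphM /= (half_invJ minus_rels true) rmorph1. Qed.

Let antipode_F i : antipode Hfm (y_ (HX i))
  = - (y_ (HJ false i) * y_ (HX i) * y_ (HK false i)).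
Proof.
case: HAmP => _ _ _ SF; case: pimH => _ _ pimS.
by rewrite /y_ pimS SF raddfN /= !rmorphM.
Qed.

Let psi_K i j : [/\ psi (x_ (HK true i)) (y_ (HK true j)) = ⟨i, j⟩,
  psi (x_ (HK true i)) (y_ (HJ true j)) = 1 & psi (x_ (HK true i)) (y_ (HX j)) = 0].
Proof. by rewrite !psi_phi; apply: (phi_K HAmP phiP). Qed.

Let psi_J i j : [/\ psi (x_ (HJ true i)) (y_ (HK true j)) = ξ j i,
  psi (x_ (HJ true i)) (y_ (HJ true j)) = 1 & psi (x_ (HJ true i)) (y_ (HX j)) = 0].
Proof. by rewrite !psi_phi; apply: (phi_J HAmP phiP). Qed.

Let psi_E i j : [/\ psi (x_ (HX i)) (y_ (HK true j)) = 0,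
  psi (x_ (HX i)) (y_ (HJ true j)) = 0 &
  psi (x_ (HX i)) (y_ (HX j))
    = if i == j then ((v_ P i)^-1 - v_ P i)^-1 * ξ i i else 0].
Proof. by rewrite !psi_phi; apply: (phi_E phiP). Qed.

(* [S F_j = - J'_j^-1 F_j K'_j^-1], and a group-like element pairs
   multiplicatively. *)
Let psi_torus_SF g j : is_torus g -> psi (x_ g) (y_ (HX j)) = 0 ->
  psi (x_ g) (antipode Hfm (y_ (HX j))) = 0.
Proof.
move=> /plus_group_like Tg xF0; rewrite antipode_F linearNr /=.
by rewrite !(pairing_group_likeM psiP _ _ Tg) xF0 mulr0 mul0r oppr0.
Qed.

(* Pairing [E_i] with [- J'_j^-1 F_j K'_j^-1] leaves only the term where [E_i]
   meets [F_j], while [K_i] meets [J'_j^-1] and [J_i] meets [K'_j^-1]. The last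
   factor [xi^-1] cancels the one in [psi(E_i, F_i)]. *)
Let psi_E_SF i j : psi (x_ (HX i)) (antipode Hfm (y_ (HX j)))
  = if i == j then (v_ P i - (v_ P i)^-1)^-1 else 0.
Proof.
have [gJ gK _ _] := skew_E i.
have [_ KJ KF] := psi_K i j; have [JK JJ JF] := psi_J i j; have [EK EJ EF] := psi_E i j.
have EJV : psi (x_ (HX i)) (y_ (HJ false j)) = 0.
  have : psi (x_ (HX i)) (y_ (HJ true j) * y_ (HJ false j)) = 0.
    by rewrite y_JV (pairing1r psiP); case: (skew_E i).
  by rewrite (pairing_skew_primitiveM psiP _ _ (skew_E i)) EJ KJ mul0r add0r mul1r.
have KJV : psi (x_ (HK true i)) (y_ (HJ false j)) = 1.
  by rewrite (pairing_inv psiP gK (y_JV j)) KJ invr1.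
have JKV : psi (x_ (HJ true i)) (y_ (HK false j)) = (ξ j i)^-1.
  by rewrite (pairing_inv psiP gJ (y_KV j)) JK.
rewrite antipode_F linearNr /= (pairing_skew_primitiveM psiP _ _ (skew_E i)).
rewrite (pairing_skew_primitiveM psiP _ _ (skew_E i)).
rewrite (pairing_group_likeM psiP _ _ gK) EJV KJV KF EF JKV.
rewrite !mul1r mul0r add0r mul0r addr0; case: eqP => [<-|_]; last by rewrite mul0r oppr0.
have xi0 : ξ i i != 0 by case: (xi_mult P).
by rewrite mulfK // -[LHS]invrN opprB.
Qed.

Local Notation u_ := (double_generators t (fun g => pip (gp g)) (fun g => pim (gm g))).

Lemma double_relations_hold : double_rels P u_.
Proof.
have [eA [eB [eAE eBE]]] := double_morphisms UP.
have ulE h : u_ (inl h) = eA (pip (gp h)) by rewrite eAE.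
have urE h : u_ (inr h) = eB (pim (gm h)) by rewrite eBE.
split.
- have /(half_rels_morph eA) := half_rels_morph pip plus_rels.
  by congr half_rels; apply/funext=> g; rewrite ulE.
- have /(half_rels_morph eB) := half_rels_morph pim minus_rels.
  by congr half_rels; apply/funext=> g; rewrite urE.
- move=> g h Tg Th; apply: (double_group_like psiP UP).
    exact: plus_group_like.
  exact: minus_group_like.
- move=> i j; have [JK _ _] := psi_J j i; have [KK _ _] := psi_K j i.
  have [EK _ _] := psi_E j i.
  rewrite /= (double_skew_left psiP UP (skew_E j) (minus_group_like _) EK) //.
  by rewrite KK JK.
- move=> i j; have [_ JJ _] := psi_J j i; have [_ KJ _] := psi_K j i.
  have [_ EJ _] := psi_E j i.
  rewrite /= (double_skew_left psiP UP (skew_E j) (minus_group_like _) EJ) //.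
  by rewrite KJ JJ invr1 mulr1 scale1r.
- move=> i j; have [KK KJ KF] := psi_K i j.
  have gK := @plus_group_like (HK true i) erefl.
  have gK' := @minus_group_like (HK true j) erefl.
  rewrite /= (double_skew_right psiP UP gK (skew_F j) KF) ?psi_torus_SF //.
  rewrite KK KJ invr1 mul1r scalerA mulVf ?scale1r // -KK.
  exact: (pairing_neq0 psiP gK gK').
- move=> i j; have [JK JJ JF] := psi_J i j.
  have gJ := @plus_group_like (HJ true i) erefl.
  have gK' := @minus_group_like (HK true j) erefl.
  rewrite /= (double_skew_right psiP UP gJ (skew_F j) JF) ?psi_torus_SF //.
  rewrite JK JJ invr1 mul1r scalerA mulVf ?scale1r // -JK.
  exact: (pairing_neq0 psiP gJ gK').
- move=> i j; have [JK JJ JF] := psi_J i j; have [_ KJ KF] := psi_K i j.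
  have [EK EJ EF] := psi_E i j.
  have xi0 : ξ j i != 0 by case: (xi_mult P).
  have KSF := psi_torus_SF (g := HK true i) erefl KF.
  rewrite /= (double_skew_skew psiP UP (skew_E i) (skew_F j) EK EJ JF KSF).
  rewrite EF psi_E_SF JK KJ invr1 !mul1r; case: eqP => [<-|_].
    by apply: cross_combination; case: (xi_mult P).
  by rewrite mul0r !scale0r add0r addr0 scalerA mulVf // scale1r subrr.
- move=> i j ij; rewrite !ulE -(serre_sum_morph P eA) -(serre_sum_morph P pip).
  rewrite -(eval_D P (fun i => gp (HX i))).
  suff -> : pip (eval (fun i => gp (HX i)) (D_ P i j)) = 0 by apply: raddf0.
  by apply/pipP.2/Ideal_gen; exists i, j.
- move=> i j ij; rewrite !urE -(serre_sum_op_morph P eB) -(serre_sum_op_morph P pim).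
  rewrite -(anti_eval_D P (fun i => gm (HX i))).
  suff -> : pim (anti_eval (fun i => gm (HX i)) (D_ P i j)) = 0 by apply: raddf0.
  by apply/pimP.2/Ideal_gen; exists i, j.
Qed.

End DoubleRelationsHold.

(** * No further relations *)

Section Straightening.
Variables (F : fieldType) (I : finType) (P : parameters F I).

Lemma bracket_neq0 mu nu : bracket P mu nu != 0.
Proof.
have v0 : v P != 0 by rewrite fmorph_eq0 tofrac_eq0 polyX_eq0.
have b0 : beta P mu nu != 0 by case: (beta_mult P).
have x0 : xi P nu mu != 0 by case: (xi_mult P).
by rewrite !mulf_neq0 // expfz_neq0.
Qed.

Lemma scaled_comm_sym (B : algType F) (a x : B) (c : F) : c != 0 ->
  a * x = c *: (x * a) -> x * a = c^-1 *: (a * x).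
Proof. by move=> c0 ->; rewrite scalerA mulVf // scale1r. Qed.

(** Conjugating the scaled commutation by the inverse inverts the scalar. *)
Lemma scaled_comm_sign (B : algType F) (a : bool -> B) (x : B) (c : F) s :
    c != 0 -> (forall s, a s * a (~~ s) = 1) ->
    a true * x = c *: (x * a true) ->
  a s * x = (if s then c else c^-1) *: (x * a s).
Proof.
move=> c0 aV ax; case: s => //; apply: scaled_comm_sym => //.
rewrite -[x in LHS]mul1r -(aV false) /= -(mulrA (a false)) ax.
by rewrite -scalerAr -scalerAl -!mulrA (aV true) mulr1.
Qed.

(** A minus generator moves to the right of a plus generator at the cost of products
    of the same shape. The coefficients are chosen before the algebra [B], so the
    same formula holds in the double and in the algebra presented by the relations. *)
Lemma straightening (g h : half_gen I) :
  exists s : seq (F * (half_gen I * half_gen I)),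
    forall (B : algType F) (k : double_gen I -> B), double_rels P k ->
      k (inr h) * k (inl g)
        = \sum_(e <- s) e.1 *: (k (inl e.2.1) * k (inr e.2.2)).
Proof.
have single c : (forall (B : algType F) (k : double_gen I -> B), double_rels P k ->
      k (inr h) * k (inl g) = c *: (k (inl g) * k (inr h))) ->
    exists s : seq (F * (half_gen I * half_gen I)),
      forall (B : algType F) (k : double_gen I -> B), double_rels P k ->
        k (inr h) * k (inl g)
          = \sum_(e <- s) e.1 *: (k (inl e.2.1) * k (inr e.2.2)).
  by move=> sw; exists [:: (c, (g, h))] => B k kP; rewrite big_seq1 sw.
have xi0 i j : xi P (simple i) (simple j) != 0 by case: (xi_mult P).
have br0 i j : bracket P (simple i) (simple j) != 0 by apply: bracket_neq0.
have [Tg|] := boolP (is_torus g); have [Th|] := boolP (is_torus h).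
- by apply: (single 1) => B k kP; rewrite scale1r (double_comm kP).
- have sign0 (c : F) s : c != 0 -> (if s then c else c^-1) != 0.
    by case: s; rewrite ?invr_eq0.
  case: h single => // j single _; case: g Tg single => // s i _ single.
    pose c := (bracket P (simple i) (simple j))^-1.
    have c0 : c != 0 by rewrite invr_eq0.
    apply: (single (if s then c else c^-1)^-1) => B k kP.
    apply: (scaled_comm_sym (sign0 _ s c0)).
    apply: (scaled_comm_sign (a := fun s => k (inl (HK s i))) s c0).
      by move=> ?; apply: (half_invK (double_plus kP)).
    exact: (double_KF kP).
  pose c := (xi P (simple j) (simple i))^-1.
  have c0 : c != 0 by rewrite invr_eq0.
  apply: (single (if s then c else c^-1)^-1) => B k kP.
  apply: (scaled_comm_sym (sign0 _ s c0)).
  apply: (scaled_comm_sign (a := fun s => k (inl (HJ s i))) s c0).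
    by move=> ?; apply: (half_invJ (double_plus kP)).
  exact: (double_JF kP).
- case: g single => // j single _; case: h Th single => // s i _ single.
    pose c := (bracket P (simple j) (simple i))^-1 * xi P (simple i) (simple j).
    have c0 : c != 0 by rewrite mulf_neq0 ?invr_eq0.
    apply: (single (if s then c else c^-1)) => B k kP.
    apply: (scaled_comm_sign (a := fun s => k (inr (HK s i))) s c0).
      by move=> ?; apply: (half_invK (double_minus kP)).
    exact: (double_K'E kP).
  apply: (single (if s then 1 else 1^-1)) => B k kP.
  apply: (scaled_comm_sign (a := fun s => k (inr (HJ s i))) s (oner_neq0 F)).
    by move=> ?; apply: (half_invJ (double_minus kP)).
  by rewrite scale1r; apply: (double_J'E kP).
case: h {single} => // j _; case: g => // i _.
pose z := xi P (simple j) (simple i).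
pose c := if i == j then z * (v_ P i - (v_ P i)^-1)^-1 else 0.
exists [:: (z, (HX i, HX j)); (c, (HJ true i, HK true i)); (- c, (HK true i, HJ true i))].
move=> B k kP; rewrite !big_cons big_nil addr0 /=.
have z0 : z != 0 by apply: xi0.
have /eqP := double_EF kP i j; rewrite subr_eq addrC -subr_eq => /eqP.
move=> /(congr1 ( *:%R z)); rewrite scalerA mulfV // scale1r => <-.
rewrite scalerBr; congr (_ + _); rewrite /c; case: eqP => _.
  by rewrite scalerA -scalerN opprB scalerBr scaleNr.
by rewrite oppr0 !scale0r addr0 scaler0 oppr0.
Qed.

Section Universal.
Variables (Ap Am : algType F) (gp : half_gen I -> Ap) (gm : half_gen I -> Am).
Hypothesis presAp : presented_by gp (plus_relation P).
Hypothesis presAm : presented_by gm (minus_relation P).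
Variables (fp fm : algType F).
Variables (pip : {lrmorphism Ap -> fp}) (pim : {lrmorphism Am -> fm}).
Hypothesis pipP : is_quotient pip (plus_serre P gp).
Hypothesis pimP : is_quotient pim (minus_serre P gm).

Lemma plus_universal (Q : algType F) (q : double_gen I -> Q) : double_rels P q ->
  exists f : {lrmorphism fp -> Q}, forall g, f (pip (gp g)) = q (inl g).
Proof.
move=> qP; have [f fE] := presented_factor presAp ((half_relsP _ _ _).1 (double_plus qP)).
have fg g : f (gp g) = q (inl g) by rewrite -(eval_letter gp) fE eval_letter.
have [|f' f'E] := quotient_factor (f := f) pipP; last first.
  by exists f' => g; rewrite f'E fg.
move=> _ [i [j [ij ->]]]; rewrite eval_D serre_sum_morph /= !fg.
exact: double_serreE qP _ _ ij.
Qed.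

Lemma minus_universal (Q : algType F) (q : double_gen I -> Q) : double_rels P q ->
  exists f : {lrmorphism fm -> Q}, forall g, f (pim (gm g)) = q (inr g).
Proof.
move=> qP; have [f fE] := presented_factor presAm ((half_relsP _ _ _).1 (double_minus qP)).
have fg g : f (gm g) = q (inr g) by rewrite -(eval_letter gm) fE eval_letter.
have [|f' f'E] := quotient_factor (f := f) pimP; last first.
  by exists f' => g; rewrite f'E fg.
move=> _ [i [j [ij ->]]]; rewrite anti_eval_D serre_sum_op_morph /= !fg.
exact: double_serreF qP _ _ ij.
Qed.

(** The quotient half is spanned by words in the images of the generators. *)
Lemma plus_ind (p : fp -> Prop) :
    p 1 -> (forall g x, p x -> p (pip (gp g) * x)) ->
    (forall c x y, p x -> p y -> p (c *: x + y)) ->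
  forall x, p x.
Proof.
move=> p1 pM pL x; have [a <-] := pipP.1 x; have [z <-] := presAp.1 a.
elim/free_alg_ind: z => [|g z IHz|c y z IHy IHz]; first by rewrite !rmorph1.
  by rewrite !rmorphM /= eval_letter; apply: pM.
by rewrite !linearP; apply: pL.
Qed.

Lemma minus_ind (p : fm -> Prop) :
    p 1 -> (forall g x, p x -> p (pim (gm g) * x)) ->
    (forall c x y, p x -> p y -> p (c *: x + y)) ->
  forall x, p x.
Proof.
move=> p1 pM pL x; have [a <-] := pimP.1 x; have [z <-] := presAm.1 a.
elim/free_alg_ind: z => [|g z IHz|c y z IHy IHz]; first by rewrite !rmorph1.
  by rewrite !rmorphM /= eval_letter; apply: pM.
by rewrite !linearP; apply: pL.
Qed.

Variables (Hfp : hopf_algebra fp) (Hfm : hopf_algebra fm).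
Variable psi : {bilinear fp -> fm -> F | *%R & *%R}.
Variables (U : algType F) (t : {linear tens fp fm -> U}).
Hypothesis UP : is_drinfeld_double Hfp Hfm psi t.

Local Notation u_ := (double_generators t (fun g => pip (gp g)) (fun g => pim (gm g))).

Hypothesis uP : double_rels P u_.

Lemma double_generated (u : U) : exists a, eval u_ a = u.
Proof.
have [eA [eB [eAE eBE]]] := double_morphisms UP.
have [z ->] := double_span UP u; elim/tens_ind: z => [x y|z z' [a aE] [b bE]]; last first.
  by exists (a + b); rewrite !raddfD /= aE bE.
rewrite (double_pure UP) -eAE -eBE.
have [a <-] : exists a, eval u_ a = eA x.
  elim/plus_ind: x => [|g x [a aE]|c x x' [a aE] [b bE]].
  - by exists 1; rewrite !rmorph1.
  - by exists (letter F (inl g) * a); rewrite !rmorphM /= eval_letter aE /u_ -eAE.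
  - by exists (c *: a + b); rewrite !linearP /= aE bE.
have [b <-] : exists b, eval u_ b = eB y.
  elim/minus_ind: y => [|g y [b bE]|c y y' [b bE] [d dE]].
  - by exists 1; rewrite !rmorph1.
  - by exists (letter F (inr g) * b); rewrite !rmorphM /= eval_letter bE /u_ -eBE.
  - by exists (c *: b + d); rewrite !linearP /= bE dE.
by exists (a * b); rewrite rmorphM.
Qed.

(** An equality of words in the double holds wherever the relations do. The proof
    compares the two evaluations through the linear map [M] with
    [M (x y) = fA(x) fB(y)]. *)
Lemma double_universal (Q : algType F) (q : double_gen I -> Q) : double_rels P q ->
  forall a, eval u_ a = 0 -> eval q a = 0.
Proof.
move=> qP.
have [eA [eB [eAE eBE]]] := double_morphisms UP.
have [fA fAE] := plus_universal qP; have [fB fBE] := minus_universal qP.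
have fP : is_bilinear (fun x y => fA x * fB y).
  split=> [y c x x'|x c y y']; first by rewrite linearP mulrDl -scalerAl.
  by rewrite linearP mulrDr -scalerAr.
pose L := tens_lift (fun x y => fA x * fB y).
have [[t' tK t'K] _ _ _ _] := UP.
have t'_lin c u v : t' (c *: u + v) = c *: t' u + t' v.
  by apply: (can_inj tK); rewrite linearP !t'K.
pose M u := L (t' u).
have M_lin c u v : M (c *: u + v) = c *: M u + M v.
  by rewrite /M t'_lin; apply: (tens_lift_linear fP).
have ME x y : M (eA x * eB y) = fA x * fB y.
  by rewrite eAE eBE -(double_pure UP) /M tK; apply: (tens_lift_pure fP).
have M0 : M 0 = 0 by have := M_lin (-1) 0 0; rewrite !scaleN1r !addNr.
have MD u v : M (u + v) = M u + M v.
  by have := M_lin 1 u v; rewrite !scale1r.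
have MZ c u : M (c *: u) = c *: M u by have := M_lin c u 0; rewrite M0 !addr0.
have Mspan (p : U -> Prop) : (forall x y, p (eA x * eB y)) ->
    (forall u v, p u -> p v -> p (u + v)) -> forall u, p u.
  move=> pE pD u; have [z ->] := double_span UP u.
  elim/tens_ind: z => [x y|z z' IHz IHz']; last by rewrite raddfD; apply: pD.
  by rewrite (double_pure UP) -eAE -eBE.
have Mplus g u : M (u_ (inl g) * u) = q (inl g) * M u.
  elim/Mspan: u => [x y|u v IHu IHv]; last by rewrite mulrDr !MD IHu IHv mulrDr.
  by rewrite /= -eAE mulrA -rmorphM !ME rmorphM /= fAE mulrA.
have Mminus h u : M (u_ (inr h) * u) = q (inr h) * M u.
  elim/Mspan: u => [x y|u v IHu IHv]; last by rewrite mulrDr !MD IHu IHv mulrDr.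
  (* The induction on the plus factor is for all [h] at once: exchanging [h] with
     the first letter produces other minus generators. *)
  elim/plus_ind: x h => [|g x IHx|c x x' IHx IHx'] h.
  - have := ME 1 (pim (gm h) * y); have := ME 1 y; rewrite !rmorph1 !mul1r => -> .
    by rewrite !rmorphM /= fBE eBE.
  - have [s sE] := straightening g h.
    rewrite rmorphM /= -mulrA eAE -/(u_ (inl g)) mulrA (sE _ _ uP) mulr_suml.
    rewrite Mplus mulrA (sE _ _ qP) mulr_suml (big_morph M MD M0).
    apply: eq_bigr => e _; rewrite -!scalerAl MZ -!mulrA Mplus.
    by rewrite IHx.
  - by rewrite linearP /= mulrDl mulrDr -scalerAl -scalerAr !M_lin IHx IHx'
      mulrDr -scalerAr.
have Meval a : M (eval u_ a) = eval q a.
  elim/free_alg_ind: a => [|g a IHa|c a b IHa IHb].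
  - by have := ME 1 1; rewrite !rmorph1 !mul1r.
  - by rewrite !rmorphM /= !eval_letter -IHa; case: g.
  - by rewrite !linearP /= M_lin IHa IHb.
by move=> a a0; rewrite -Meval a0.
Qed.

End Universal.

End Straightening.

(** * The presentation *)

Theorem mainTheorem3 (F : fieldType) (I : finType) (P : parameters F I)
    (* the Hopf algebras hat 'f+ and hat 'f- *)
    (Ap Am : algType F) (gp : half_gen I -> Ap) (gm : half_gen I -> Am)
    (presAp : presented_by gp (plus_relation P))
    (presAm : presented_by gm (minus_relation P))
    (HAp : hopf_algebra Ap) (HAm : hopf_algebra Am)
    (HApP : plus_hopf_spec gp HAp) (HAmP : minus_hopf_spec gm HAm)
    (phi : Ap -> Am -> F) (phiP : is_phi P gp gm HAm phi)
    (* their quotients hat f+ and hat f- with the induced structures *)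
    (fp fm : algType F) (pip : {lrmorphism Ap -> fp}) (pim : {lrmorphism Am -> fm})
    (pipP : is_quotient pip (plus_serre P gp))
    (pimP : is_quotient pim (minus_serre P gm))
    (Hfp : hopf_algebra fp) (Hfm : hopf_algebra fm)
    (pipH : hopf_morphism HAp Hfp pip) (pimH : hopf_morphism HAm Hfm pim)
    (psi : {bilinear fp -> fm -> F | *%R & *%R})
    (psi_phi : forall x y, psi (pip x) (pim y) = phi x y)
    (psi_skew : skew_hopf_pairing Hfp Hfm psi)
    (* the Drinfeld double *)
    (U : algType F) (t : {linear tens fp fm -> U})
    (UP : is_drinfeld_double Hfp Hfm psi t) :
  presented_by
    (fun g : double_gen I => match g with
      | inl h => t (pip (gp h) ⊗ 1)
      | inr h => t (1 ⊗ pim (gm h))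
      end)
    (double_relation P).
Proof.
have uP := double_relations_hold presAp presAm HApP HAmP phiP pipP pimP pipH pimH
  psi_phi psi_skew UP.
split=> [u|z]; first by have [a <-] := double_generated presAp presAm pipP pimP UP u; exists a.
set u_ := fun g => _; set S := fun z => _.
have u_S x : ideal_gen S x -> eval u_ x = 0.
  apply: (ideal_gen_vanish (f := eval u_)) => _ [l [r [lr ->]]].
  by rewrite raddfB /= ((double_relsP P u_).1 uP l r lr) subrr.
split=> [z0|]; last exact: u_S.
have S1 : ~ ideal_gen S 1.
  by move=> /u_S; rewrite rmorph1 => /eqP; rewrite oner_eq0.
have [Q [p pP]] := quotient_exists (@free_scaleAr F _) S1.
pose q g := p (letter F g).
have qE x : eval q x = p x by apply: eval_unique.
have qP : double_rels P q.
  apply/double_relsP => l r lr; apply/eqP; rewrite !qE -subr_eq0 -raddfB.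
  by apply/eqP/pP.2/Ideal_gen; exists l, r.
apply/pP.2; rewrite -qE.
exact: (double_universal presAp presAm pipP pimP UP uP qP z0).
Qed.
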